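(* Let $Z=z_1e_1+z_2e_2$ and $\mathcal V=\nu_1e_1+\nu_2e_2=\alpha_1+j\alpha_2$ be elements of $\mathbb{BC}$ with $\Re(\alpha_1)+\frac12>|\Im(\alpha_2)|$. Then $$\mathcal J_{\mathcal V}(Z)=\frac{2^{\mathcal V}}{\sqrt\pi}\sum_{s=0}^{\infty}\frac{(-1)^sZ^{\mathcal V+2s}}{s!\,\Gamma_b(2\mathcal V+2s+1)}\int_\gamma e^{-t}t^{\mathcal V+s-\frac12}\,dt,$$ where $t=t_1e_1+t_2e_2\in\mathbb{BC}$ and $\gamma=(\gamma_1,\gamma_2)$ is the curve in $\mathbb{BC}$ given by $0<t_1,t_2<\infty$.
   Context: Bicomplex numbers: $\mathbb{BC}=\{\lambda_1+j\lambda_2:\lambda_1,\lambda_2\in\mathbb C(i)\}$ with commuting units $i,j$, $i^2=j^2=-1$, $k=ij$, $k^2=1$. Put $e_1=\frac{1+k}{2}$, $e_2=\frac{1-k}{2}$; then $e_1+e_2=1$, $e_l^2=e_l$, $e_1e_2=0$. Every $Z=\lambda_1+j\lambda_2$ has the unique idempotent representation $Z=z_1e_1+z_2e_2$ with $z_1=\lambda_1-i\lambda_2$, $z_2=\lambda_1+i\lambda_2\in\mathbb C(i)$. In particular $\nu_1=\alpha_1-i\alpha_2$, $\nu_2=\alpha_1+i\alpha_2$. Elementary functions act componentwise: $e^{-t}=e^{-t_1}e_1+e^{-t_2}e_2$. $Z^{\mathcal V}=z_1^{\nu_1}e_1+z_2^{\nu_2}e_2$, with complex powers $z^\nu=\exp(\nu\log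 z)$ for a fixed branch of $\log$ used consistently (the real branch for positive reals; at $z=0$ only when the power makes sense). $\Gamma_b(Z)=\Gamma(z_1)e_1+\Gamma(z_2)e_2$, with $1/\Gamma$ read as an entire function. Integration is componentwise: for $\gamma=(\gamma_1,\gamma_2)$ and $g(t)=g_1(t_1)e_1+g_2(t_2)e_2$, $\int_\gamma g(t)\,dt=\left(\int_{\gamma_1}g_1(t_1)dt_1\right)e_1+\left(\int_{\gamma_2}g_2(t_2)dt_2\right)e_2$; here $\gamma_1,\gamma_2$ are the real half-line $(0,\infty)$. Bicomplex Bessel function: for $\mathcal V,Z\in\mathbb{BC}$, $$\mathcal J_{\mathcal V}(Z)=\sum_{s=0}^\infty\frac{(-1)^s}{\Gamma_b(\mathcal V+s+1)s!}\left(\frac Z2\right)^{\mathcal V+2s},$$ equivalently $\mathcal J_{\mathcal V}(Z)=J_{\nu_1}(z_1)e_1+J_{\nu_2}(z_2)e_2$ with $J_\nu$ the classical Bessel function of the first kind. *)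

(* Defs.v *)
From Stdlib Require Import Reals Lra ZArith.
From Coquelicot Require Import Coquelicot.

Open Scope R_scope.

(** * Complex functions *)

Definition Cexp (z : C) : C :=
  (exp (Re z) * cos (Im z), exp (Re z) * sin (Im z)).

(** A determination of the argument, real on the positive axis.  It is constant
    on rays from the origin (the cut is a union of rays), so that [log (r z) =
    ln r + log z] for [r > 0]: the same determination is used at [z] and at
    [z / 2].  The value of [arg 0] is irrelevant. *)
Record arg_branch (arg : C -> R) : Prop := {
  arg_polar : forall z : C, z <> 0 ->
    z = (Cmod z * cos (arg z), Cmod z * sin (arg z));
  arg_ray : forall (r : R) (z : C), 0 < r -> z <> 0 ->
    arg (RtoC r * z)%C = arg z;
  arg_pos : forall x : R, 0 < x -> arg (RtoC x) = 0
}.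

Definition Clog (arg : C -> R) (z : C) : C := (ln (Cmod z), arg z).

(** At [z = 0] the power makes sense when [0 < Re nu] (value 0) or [nu = 0]
    (value 1); see [Cpower_defined]. *)
Definition Cpower (arg : C -> R) (z nu : C) : C :=
  if Ceq_dec z 0 then (if Ceq_dec nu 0 then RtoC 1 else RtoC 0)
  else Cexp (nu * Clog arg z)%C.

Definition Cpower_defined (z nu : C) : Prop :=
  z <> 0 \/ 0 < Re nu \/ nu = 0.

Definition Cseries (a : nat -> C) : C :=
  iota (is_series (V := C_CompleteNormedModule) a).

(** Integral over the half-line [0 < t < oo], improper at both ends. *)
Definition is_Cint (f : R -> C) (I : C) : Prop :=
  is_RInt_gen (V := C_R_CompleteNormedModule) f
    (at_right 0) (Rbar_locally p_infty) I.

Definition Cint (f : R -> C) : C :=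
  RInt_gen (V := C_R_CompleteNormedModule) f
    (at_right 0) (Rbar_locally p_infty).

(** Euler's integral, equal to Gamma on the half-plane [0 < Re z]. *)
Definition Euler_Gamma (z : C) : C :=
  Cint (fun t => (RtoC (exp (- t)) * Cexp ((z - 1) * RtoC (ln t)))%C).

(** The least [n] with [0 < Re z + n]. *)
Definition Gamma_shift (z : C) : nat := Z.to_nat (up (- Re z)).

Fixpoint Crising (z : C) (n : nat) : C :=
  match n with
  | O => RtoC 1
  | S m => (Crising z m * (z + RtoC (INR m)))%C
  end.

(** The entire function 1/Gamma, by
    [1 / Gamma(z) = z (z+1) ... (z+n-1) / Gamma(z+n)]; it vanishes at
    0, -1, -2, ... *)
Definition rGamma (z : C) : C :=
  (Crising z (Gamma_shift z)
     / Euler_Gamma (z + RtoC (INR (Gamma_shift z))))%C.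

(** * Bicomplex numbers *)

(** [(a, b)] stands for [a + j b]. *)
Definition BC : Type := (C * C)%type.

Definition BC_NormedModule : NormedModule C_AbsRing :=
  prod_NormedModule C_AbsRing C_NormedModule C_NormedModule.

Definition CtoBC (a : C) : BC := (a, RtoC 0).
Definition RtoBC (x : R) : BC := CtoBC (RtoC x).

Definition BCplus (Z W : BC) : BC :=
  ((fst Z + fst W)%C, (snd Z + snd W)%C).
Definition BCopp (Z : BC) : BC := ((- fst Z)%C, (- snd Z)%C).
Definition BCminus (Z W : BC) : BC := BCplus Z (BCopp W).
Definition BCmult (Z W : BC) : BC :=
  ((fst Z * fst W - snd Z * snd W)%C, (fst Z * snd W + snd Z * fst W)%C).

Declare Scope BC_scope.
Delimit Scope BC_scope with BC.
Bind Scope BC_scope with BC.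
Infix "+" := BCplus : BC_scope.
Infix "-" := BCminus : BC_scope.
Infix "*" := BCmult : BC_scope.
Notation "- Z" := (BCopp Z) : BC_scope.

Definition BCi : BC := CtoBC Ci.
Definition BCj : BC := (RtoC 0, RtoC 1).
Definition BCk : BC := (BCi * BCj)%BC.
Definition e1 : BC := (RtoBC (/ 2) * (RtoBC 1 + BCk))%BC.
Definition e2 : BC := (RtoBC (/ 2) * (RtoBC 1 - BCk))%BC.

Definition idem (a b : C) : BC := (CtoBC a * e1 + CtoBC b * e2)%BC.
Definition idem1 (Z : BC) : C := (fst Z - Ci * snd Z)%C.
Definition idem2 (Z : BC) : C := (fst Z + Ci * snd Z)%C.

Lemma BCj_sqr : (BCj * BCj)%BC = RtoBC (-1).
Proof.
  unfold BCj, BCmult, RtoBC, CtoBC; simpl; f_equal;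
    apply injective_projections; simpl; ring.
Qed.

Lemma e1_sqr : (e1 * e1)%BC = e1.
Proof.
  unfold e1, BCk, BCi, BCj, BCmult, BCplus, RtoBC, CtoBC; simpl; f_equal;
    apply injective_projections; simpl; field.
Qed.

Lemma e1_e2 : (e1 * e2)%BC = RtoBC 0.
Proof.
  unfold e1, e2, BCk, BCi, BCj, BCmult, BCminus, BCopp, BCplus, RtoBC, CtoBC;
    simpl; f_equal; apply injective_projections; simpl; field.
Qed.

Lemma idemE (a b : C) :
  idem a b = (((a + b) / 2)%C, (Ci * (a - b) / 2)%C).
Proof.
  destruct a as [x y], b as [u v].
  unfold idem, e1, e2, BCk, BCi, BCj, BCmult, BCminus, BCopp, BCplus, RtoBC,
    CtoBC; simpl; f_equal; apply injective_projections; simpl; field.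
Qed.

Lemma idem1_idem (a b : C) : idem1 (idem a b) = a.
Proof.
  rewrite idemE; destruct a as [x y], b as [u v]; unfold idem1; simpl.
  apply injective_projections; simpl; field.
Qed.

Lemma idem2_idem (a b : C) : idem2 (idem a b) = b.
Proof.
  rewrite idemE; destruct a as [x y], b as [u v]; unfold idem2; simpl.
  apply injective_projections; simpl; field.
Qed.

Lemma idem_repr (Z : BC) : idem (idem1 Z) (idem2 Z) = Z.
Proof.
  destruct Z as [[x y] [u v]]; rewrite idemE; unfold idem1, idem2; simpl.
  f_equal; apply injective_projections; simpl; field.
Qed.

Lemma idem1_mult (Z W : BC) : idem1 (Z * W)%BC = (idem1 Z * idem1 W)%C.
Proof.
  destruct Z as [[x y] [u v]], W as [[x' y'] [u' v']].
  unfold idem1, BCmult; apply injective_projections; simpl; ring.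
Qed.

Lemma idem2_mult (Z W : BC) : idem2 (Z * W)%BC = (idem2 Z * idem2 W)%C.
Proof.
  destruct Z as [[x y] [u v]], W as [[x' y'] [u' v']].
  unfold idem2, BCmult; apply injective_projections; simpl; ring.
Qed.

(** * Bicomplex functions *)

Definition BCexp (Z : BC) : BC := idem (Cexp (idem1 Z)) (Cexp (idem2 Z)).

Definition BCpower (arg : C -> R) (Z W : BC) : BC :=
  idem (Cpower arg (idem1 Z) (idem1 W)) (Cpower arg (idem2 Z) (idem2 W)).

Definition BCpower_defined (Z W : BC) : Prop :=
  Cpower_defined (idem1 Z) (idem1 W) /\ Cpower_defined (idem2 Z) (idem2 W).

(** The function 1/Gamma_b. *)
Definition BCrGamma (Z : BC) : BC := idem (rGamma (idem1 Z)) (rGamma (idem2 Z)).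

Definition BCseries (a : nat -> BC) : BC :=
  (Cseries (fun n => fst (a n)), Cseries (fun n => snd (a n))).

Definition is_BCint (g : BC -> BC) (I : BC) : Prop :=
  exists g1 g2 : R -> C,
    (forall t1 t2 : R, 0 < t1 -> 0 < t2 ->
       g (idem (RtoC t1) (RtoC t2)) = idem (g1 t1) (g2 t2))
    /\ is_Cint g1 (idem1 I) /\ is_Cint g2 (idem2 I).

(** For [g (t1 e1 + t2 e2) = g1 t1 e1 + g2 t2 e2], the functions [g1] and [g2]
    are read off on the diagonal [t1 = t2]. *)
Definition BCint (g : BC -> BC) : BC :=
  idem (Cint (fun t => idem1 (g (idem (RtoC t) (RtoC t)))))
       (Cint (fun t => idem2 (g (idem (RtoC t) (RtoC t))))).

(** The term (-1)^s / (Gamma_b(V + s + 1) s!) (Z / 2)^(V + 2s). *)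
Definition Bessel_term (arg : C -> R) (V Z : BC) (s : nat) : BC :=
  (RtoBC ((-1) ^ s / INR (fact s)) * BCrGamma (V + RtoBC (INR s + 1))
     * BCpower arg (RtoBC (/ 2) * Z) (V + RtoBC (2 * INR s)))%BC.

Definition BCBessel (arg : C -> R) (V Z : BC) : BC :=
  BCseries (Bessel_term arg V Z).

(** The integrand e^(-t) t^(V + s - 1/2). *)
Definition Bessel_integrand (arg : C -> R) (V : BC) (s : nat) (t : BC) : BC :=
  (BCexp (- t) * BCpower arg t (V + RtoBC (INR s - / 2)))%BC.

(** The term (-1)^s Z^(V + 2s) / (s! Gamma_b(2V + 2s + 1)) times the integral
    of e^(-t) t^(V + s - 1/2). *)
Definition Bessel_int_term (arg : C -> R) (V Z : BC) (s : nat) : BC :=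
  (RtoBC ((-1) ^ s / INR (fact s))
     * BCpower arg Z (V + RtoBC (2 * INR s))
     * BCrGamma (RtoBC 2 * V + RtoBC (2 * INR s + 1))
     * BCint (Bessel_integrand arg V s))%BC.

(** * The principal argument is a branch *)

Definition principal_arg (z : C) : R :=
  if Rle_dec 0 (Im z) then acos (Re z / Cmod z) else - acos (Re z / Cmod z).

Lemma principal_arg_branch : arg_branch principal_arg.
Proof.
  split.
  - intros [x y] Hz.
    assert (Hm : 0 < Cmod (x, y)) by (apply Cmod_gt_0; exact Hz).
    assert (Hsq : Cmod (x, y) * Cmod (x, y) = x * x + y * y).
    { unfold Cmod; simpl; rewrite sqrt_sqrt; [ring | nra]. }
    unfold principal_arg; simpl; set (m := Cmod (x, y)) in *.
    assert (Hb : -1 <= x / m <= 1).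
    { assert (Hx : - m <= x <= m) by (split; nra).
      split; [apply Rle_div_r | apply Rle_div_l]; lra. }
    assert (Hs : m * sin (acos (x / m)) = Rabs y).
    { rewrite sin_acos by exact Hb.
      replace (1 - Rsqr (x / m)) with (Rsqr (y / m)).
      - rewrite sqrt_Rsqr_abs, Rabs_div by lra.
        rewrite (Rabs_pos_eq m) by lra; field; lra.
      - assert (Hy : y * y = m * m - x * x) by lra.
        replace (Rsqr (y / m)) with (y * y / (m * m))
          by (unfold Rsqr; field; lra).
        rewrite Hy; unfold Rsqr; field; lra. }
    destruct (Rle_dec 0 y) as [Hy | Hy].
    + rewrite Hs, cos_acos by exact Hb.
      rewrite Rabs_pos_eq by exact Hy; f_equal; field; lra.
    + rewrite cos_neg, sin_neg, cos_acos by exact Hb.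
      replace (m * - sin (acos (x / m))) with (- (m * sin (acos (x / m))))
        by ring.
      rewrite Hs, Rabs_left by lra; f_equal; [field; lra | ring].
  - intros r z Hr Hz.
    assert (Hm : 0 < Cmod z) by (apply Cmod_gt_0; exact Hz).
    unfold principal_arg.
    rewrite re_scal_l, im_scal_l, Cmod_mult, Cmod_R, Rabs_pos_eq by lra.
    replace (r * Re z / (r * Cmod z)) with (Re z / Cmod z) by (field; lra).
    destruct (Rle_dec 0 (Im z)), (Rle_dec 0 (r * Im z)); try reflexivity;
      exfalso; nra.
  - intros x Hx; unfold principal_arg.
    rewrite re_RtoC, im_RtoC, Cmod_R, Rabs_pos_eq by lra.
    replace (x / x) with 1 by (field; lra); rewrite acos_1.
    destruct (Rle_dec 0 0); lra.
Qed.

(* Main.v *)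
Require Import Defs.
From Stdlib Require Import Reals Lra Lia Arith.
From Coquelicot Require Import Coquelicot.

(** In each idempotent component the two series agree term by term, by Legendre's
    duplication formula at [w = nu + s + 1/2] (so [0 < Re w]).  The formula comes
    from Euler's limit [Gamma (z + n) / ((n - 1)! n^z) --> 1]: the quotient
    [Gamma w * Gamma (w + 1/2) * 4^w / Gamma (2 w)] is unchanged by [w |-> w + 1],
    and its limit along [w + n] is a constant independent of [w], which Wallis'
    product evaluates.  The same limit shows that Gamma has no zero for [0 < Re z]. *)

(** * Integrals over the half-line *)

(** Since the arguments are complex, no convexity argument can characterise Gamma; Euler's limit
    takes that role. It is a concentration statement: for the probability density [t^n e^(-t) / n!],
    of mean [n + 1], the variable [u = t / (n + 1)] is close to 1, so the mean of [u^z] tends to 1.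
    For [0 < Re z <= 1] the square [|u^z - 1|^2] lies below a multiple of [2 u^2 - 3 u + 1/u], which
    vanishes at [u = 1] and whose mean is an explicit combination of factorials. Hence no limit is
    ever taken under an integral sign, and the recurrence carries the result from the strip to the
    half-plane. The condition on [V] says that both components [nu] satisfy [-1/2 < Re nu]. Every
    Gamma argument then has positive real part, so [rGamma] is a genuine inverse of Euler's integral
    and the integrals converge at 0. *)

Definition is_Rint (f : R -> R) (l : R) : Prop :=
  is_RInt_gen f (at_right 0) (Rbar_locally p_infty) l.

Lemma at_right_0_pos : at_right 0 (fun x => 0 < x).
Proof. exists (mkposreal 1 Rlt_0_1); intros y _ Hy; exact Hy. Qed.

Lemma p_infty_pos : Rbar_locally p_infty (fun x => 0 < x).
Proof. exists 0; intros y Hy; exact Hy. Qed.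

Lemma half_line_prod (P : R * R -> Prop) :
  (forall a b, 0 < a -> 0 < b -> P (a, b)) ->
  filter_prod (at_right 0) (Rbar_locally p_infty) P.
Proof.
  intros H; exists (fun x => 0 < x) (fun x => 0 < x);
    [exact at_right_0_pos | exact p_infty_pos | exact H].
Qed.

(** The product filter does not order its two endpoints; cutting at 1 does, as norm estimates on an
    integral require. *)
Lemma half_line_le :
  filter_prod (at_right 0) (Rbar_locally p_infty)
    (fun ab : R * R => 0 < fst ab <= snd ab).
Proof.
  exists (fun x => 0 < x < 1) (fun x => 1 < x).
  - exists (mkposreal 1 Rlt_0_1); intros y Hb Hy.
    unfold ball in Hb; simpl in Hb; unfold AbsRing_ball, abs, minus, plus, opp in Hb;
      simpl in Hb; apply Rabs_def2 in Hb; lra.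
  - exists 1; auto.
  - simpl; intros; lra.
Qed.

(** Integration and mean value lemmas describe an interval by [Rmin] and [Rmax] of its ends; this
    keeps its points positive. *)
Lemma Rmin_pos_le (a b x : R) : 0 < a -> 0 < b -> Rmin a b <= x -> 0 < x.
Proof. intros Ha Hb; assert (0 < Rmin a b) by (apply Rmin_glb_lt; auto); lra. Qed.

Lemma is_Rint_ext (f g : R -> R) (l : R) :
  (forall t, 0 < t -> f t = g t) -> is_Rint f l -> is_Rint g l.
Proof.
  intros H; apply is_RInt_gen_ext, half_line_prod.
  intros a b Ha Hb x [Hx _]; apply H, (Rmin_pos_le a b); simpl in *; lra.
Qed.

Lemma filterlim_Rminus {T : Type} (F : (T -> Prop) -> Prop) (FF : Filter F)
    (f g : T -> R) (a b : R) :
  filterlim f F (locally a) -> filterlim g F (locally b) ->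
  filterlim (fun x => f x - g x) F (locally (a - b)).
Proof.
  intros Hf Hg.
  apply (filterlim_comp_2 f g (fun x y : R => x - y) Hf Hg).
  apply (filterlim_comp_2 (fun z : R * R => fst z) (fun z : R * R => - snd z)
    Rplus (G := locally a) (H := locally (- b))).
  - apply filterlim_fst.
  - apply (filterlim_comp _ _ _ snd Ropp _ (locally b)); [apply filterlim_snd|].
    apply (filterlim_opp (V := R_NormedModule)).
  - apply (filterlim_plus (V := R_NormedModule)).
Qed.

(** The fundamental theorem of calculus on [[a, b]], followed by independent limits of the primitive
    at the two ends. *)
Lemma is_Rint_derive (F f : R -> R) (la lb : R) :
  (forall t, 0 < t -> is_derive F t (f t)) ->
  (forall t, 0 < t -> continuous f t) ->
  filterlim F (at_right 0) (locally la) ->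
  filterlim F (Rbar_locally p_infty) (locally lb) ->
  is_Rint f (lb - la).
Proof.
  intros HF Hf Ha Hb P HP.
  assert (Hm : filterlim (fun ab : R * R => minus (F (snd ab)) (F (fst ab)))
            (filter_prod (at_right 0) (Rbar_locally p_infty)) (locally (lb - la))).
  { apply (filterlim_Rminus _ _ (fun ab => F (snd ab)) (fun ab => F (fst ab))).
    - apply (filterlim_comp _ _ _ snd F) with (2 := Hb), filterlim_snd.
    - apply (filterlim_comp _ _ _ fst F) with (2 := Ha), filterlim_fst. }
  specialize (Hm P HP); unfold filtermap in Hm; unfold filtermapi.
  generalize (filter_and _ _ Hm half_line_le); apply filter_imp.
  intros [a b] [H1 H2]; simpl in *; exists (minus (F b) (F a)); split; auto.
  apply (is_RInt_derive (V := R_CompleteNormedModule)); intros x [Hx _];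
    [apply HF | apply Hf]; apply (Rmin_pos_le a b); lra.
Qed.

Lemma derive_nonneg_incr (F f : R -> R) :
  (forall t, 0 < t -> is_derive F t (f t)) ->
  (forall t, 0 < t -> 0 <= f t) ->
  forall x y, 0 < x -> x <= y -> F x <= F y.
Proof.
  intros HF Hf x y Hx Hxy.
  destruct (MVT_gen F x y f) as [c [Hc E]].
  - intros z [Hz _]; apply HF, (Rmin_pos_le x y); lra.
  - intros z [Hz _]; apply continuity_pt_filterlim.
    apply (ex_derive_continuous F); exists (f z); apply HF, (Rmin_pos_le x y); lra.
  - destruct Hc as [Hc _]. assert (0 <= f c) by (apply Hf, (Rmin_pos_le x y); lra). nra.
Qed.

Lemma incr_bounded_lim_p_infty (F : R -> R) (M : R) :
  (forall x y, 0 < x -> x <= y -> F x <= F y) ->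
  (forall t, 0 < t -> F t <= M) ->
  exists l, filterlim F (Rbar_locally p_infty) (locally l).
Proof.
  intros Hi HM.
  destruct (completeness (fun v => exists t, 0 < t /\ v = F t)) as [l [Hu Hl]].
  - exists M; intros v [t [Ht ->]]; auto.
  - exists (F 1), 1; split; [lra | reflexivity].
  - exists l; apply filterlim_locally; intros eps.
    (* If no value exceeds [l - eps], this number is an upper bound smaller than the supremum. *)
    destruct (Classical_Prop.classic (exists t, 0 < t /\ l - eps < F t)) as [[t [Ht E]]|N].
    + exists t; intros y Hy.
      assert (F t <= F y) by (apply Hi; lra).
      assert (F y <= l) by (apply Hu; exists y; split; [lra|reflexivity]).
      unfold ball; simpl; unfold AbsRing_ball, abs, minus, plus, opp; simpl.
      apply Rabs_def1; lra.
    + exfalso; assert (l <= l - eps); [|destruct eps; simpl in *; lra].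
      apply Hl; intros v [t [Ht ->]]; apply Rnot_lt_le; intros C; apply N; eauto.
Qed.

(** The inversion [s = 1/x] exchanges 0 and infinity; the sign makes [- F (/ s)] increasing
    again. *)
Lemma incr_bounded_lim_0 (F : R -> R) (M : R) :
  (forall x y, 0 < x -> x <= y -> F x <= F y) ->
  (forall t, 0 < t -> M <= F t) ->
  exists l, filterlim F (at_right 0) (locally l).
Proof.
  intros Hi HM.
  destruct (incr_bounded_lim_p_infty (fun s => - F (/ s)) (- M)) as [l Hl].
  - intros x y Hx Hxy; apply Ropp_le_contravar, Hi; [apply Rinv_0_lt_compat; lra|].
    apply Rinv_le_contravar; lra.
  - intros t Ht; apply Ropp_le_contravar, HM, Rinv_0_lt_compat, Ht.
  - exists (- l).
    apply filterlim_ext with (fun x => opp (opp (F (/ / x)))).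
    { intros x; rewrite opp_opp, Rinv_inv; reflexivity. }
    apply (filterlim_comp _ _ _ (fun x => - F (/ / x)) Ropp _ (locally l));
      [|apply (filterlim_opp (V := R_NormedModule))].
    apply (filterlim_comp _ _ _ Rinv (fun s => - F (/ s)) _ (Rbar_locally p_infty));
      [exact filterlim_Rinv_0_right | exact Hl].
Qed.

Lemma continuous_primitive (f : R -> R) :
  (forall t, 0 < t -> continuous f t) ->
  forall t, 0 < t -> is_derive (fun t => RInt f 1 t) t (f t).
Proof.
  intros Hf t Ht; apply (is_derive_RInt f _ 1); [|apply Hf, Ht].
  exists (mkposreal t Ht); intros y Hy.
  unfold ball in Hy; simpl in Hy; unfold AbsRing_ball, abs, minus, plus, opp in Hy;
    simpl in Hy; apply Rabs_def2 in Hy.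
  apply (RInt_correct (V := R_CompleteNormedModule)), (ex_RInt_continuous (V := R_CompleteNormedModule)).
  intros z [Hz _]; apply Hf, (Rmin_pos_le 1 y); lra.
Qed.

(** Comparison test for a signed [f]. With [P] a primitive of [f], the bound [|f| <= g] makes both
    [G + P] and [G - P] increasing. Being bounded, [G] and [G + P] have limits at both ends, hence
    so has [P]. *)
Lemma ex_Rint_dominated (f G g : R -> R) (M : R) :
  (forall t, 0 < t -> continuous f t) ->
  (forall t, 0 < t -> is_derive G t (g t)) ->
  (forall t, 0 < t -> Rabs (f t) <= g t) ->
  (forall t, 0 < t -> Rabs (G t) <= M) ->
  exists l, is_Rint f l.
Proof.
  intros Hf HG Hg HM.
  set (P := fun t => RInt f 1 t).
  assert (HP : forall t, 0 < t -> is_derive P t (f t)) by (apply continuous_primitive, Hf).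
  set (H1 := fun t => G t + P t); set (H2 := fun t => G t - P t).
  assert (I : forall x y, 0 < x -> x <= y -> G x <= G y).
  { apply derive_nonneg_incr with g; auto; intros t Ht.
    apply Rle_trans with (2 := Hg t Ht), Rabs_pos. }
  assert (I1 : forall x y, 0 < x -> x <= y -> H1 x <= H1 y).
  { apply derive_nonneg_incr with (fun t => g t + f t).
    - intros t Ht; apply (is_derive_plus (V := R_NormedModule)); auto.
    - intros t Ht; generalize (Hg t Ht), (Rle_abs (- f t)); rewrite Rabs_Ropp; lra. }
  assert (I2 : forall x y, 0 < x -> x <= y -> H2 x <= H2 y).
  { apply derive_nonneg_incr with (fun t => g t - f t).
    - intros t Ht; apply (is_derive_minus (V := R_NormedModule)); auto.
    - intros t Ht; generalize (Hg t Ht), (Rle_abs (f t)); lra. }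
  assert (P1 : P 1 = 0) by (apply (RInt_point (V := R_CompleteNormedModule))).
  (* As [P 1 = 0], monotonicity of [H1] and [H2] compares both with [G 1]; for [t >= 1] this gives
     [G 1 <= H1 t <= 2 G t - G 1], and the reverse for [t <= 1]. *)
  assert (B : forall t, 0 < t -> -3 * M <= H1 t <= 3 * M).
  { intros t Ht.
    assert (K1 := HM t Ht); assert (K2 := HM 1 Rlt_0_1).
    apply Rabs_le_between in K1; apply Rabs_le_between in K2.
    destruct (Rle_lt_dec 1 t) as [C|C].
    - assert (A1 := I1 1 t Rlt_0_1 C); assert (A2 := I2 1 t Rlt_0_1 C).
      unfold H1, H2 in *; lra.
    - assert (C' : t <= 1) by lra.
      assert (A1 := I1 t 1 Ht C'); assert (A2 := I2 t 1 Ht C').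
      unfold H1, H2 in *; lra. }
  assert (BG : forall t, 0 < t -> - M <= G t <= M) by (intros; apply Rabs_le_between; auto).
  destruct (incr_bounded_lim_p_infty G M) as [gp Hgp]; [exact I | intros; apply BG; auto|].
  destruct (incr_bounded_lim_0 G (- M)) as [g0 Hg0]; [exact I | intros; apply BG; auto|].
  destruct (incr_bounded_lim_p_infty H1 (3 * M)) as [hp Hhp]; [exact I1 | intros; apply B; auto|].
  destruct (incr_bounded_lim_0 H1 (-3 * M)) as [h0 Hh0]; [exact I1 | intros; apply B; auto|].
  assert (S : forall F h0 g0, Filter F -> filterlim H1 F (locally h0) ->
            filterlim G F (locally g0) -> filterlim P F (locally (h0 - g0))).
  { intros F h g' FF Hh Hg'.
    apply filterlim_ext with (fun t => H1 t - G t).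
    { intros t; unfold H1; ring. }
    apply filterlim_Rminus; auto. }
  exists ((hp - gp) - (h0 - g0)); apply is_Rint_derive with P; auto.
  - apply S; auto; apply Proper_StrongProper, at_right_proper_filter.
  - apply S; auto; apply Rbar_locally_filter.
Qed.

(** * Euler's integral *)

Lemma at_right_0_filter : Filter (at_right 0).
Proof. apply at_right_proper_filter. Qed.

Lemma p_infty_filter : Filter (Rbar_locally p_infty).
Proof. apply Rbar_locally_filter. Qed.

(** Balls of the product structure on [C] are products of balls, so convergence splits; all complex
    integrals below are handled through this equivalence. *)
Lemma is_Cint_components (f : R -> C) (I : C) :
  is_Cint f I <->
  is_Rint (fun t => Re (f t)) (Re I) /\ is_Rint (fun t => Im (f t)) (Im I).
Proof.
  destruct I as [a b]; split.
  - intros H; split; intros P HP.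
    + assert (H' : locally (T := C_R_NormedModule) (a, b) (fun z => P (fst z))).
      { destruct HP as [e He]; exists e; intros [u v] [Hu _]; apply He, Hu. }
      assert (K := H _ H'); unfold filtermapi in *; revert K; apply filter_imp; intros [u v] [y [H1 H2]].
      exists (fst y); split; [|exact H2].
      apply (is_RInt_fct_extend_fst (U := R_NormedModule) (V := R_NormedModule)), H1.
    + assert (H' : locally (T := C_R_NormedModule) (a, b) (fun z => P (snd z))).
      { destruct HP as [e He]; exists e; intros [u v] [_ Hv]; apply He, Hv. }
      assert (K := H _ H'); unfold filtermapi in *; revert K; apply filter_imp; intros [u v] [y [H1 H2]].
      exists (snd y); split; [|exact H2].
      apply (is_RInt_fct_extend_snd (U := R_NormedModule) (V := R_NormedModule)), H1.
  - intros [Ha Hb] P [e He]; simpl in Ha, Hb.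
    assert (Ha' := Ha (ball a e) (locally_ball a e)).
    assert (Hb' := Hb (ball b e) (locally_ball b e)).
    unfold filtermapi in *; assert (K := filter_and _ _ Ha' Hb'); revert K; apply filter_imp.
    intros [u v] [[ya [A1 A2]] [yb [B1 B2]]]; exists (ya, yb); split.
    + apply (is_RInt_fct_extend_pair (U := R_NormedModule) (V := R_NormedModule)); auto.
    + apply He; split; auto.
Qed.

Lemma is_Cint_unique (f : R -> C) (I : C) : is_Cint f I -> Cint f = I.
Proof.
  intros H.
  assert (P1 : ProperFilter' (at_right 0))
    by (apply Proper_StrongProper, at_right_proper_filter).
  assert (P2 : ProperFilter' (Rbar_locally p_infty))
    by (apply Proper_StrongProper, Rbar_locally_filter).
  exact (@is_RInt_gen_unique C_R_CompleteNormedModule _ _ P1 P2 f I H).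
Qed.

Lemma is_Cint_ext (f g : R -> C) (I : C) :
  (forall t, 0 < t -> f t = g t) -> is_Cint f I -> is_Cint g I.
Proof.
  intros H; rewrite !is_Cint_components; intros [H1 H2]; split;
    [apply is_Rint_ext with (2 := H1) | apply is_Rint_ext with (2 := H2)];
    intros t Ht; rewrite H; auto.
Qed.

Lemma Cint_ext (f g : R -> C) (I : C) :
  (forall t, 0 < t -> f t = g t) -> is_Cint f I -> Cint g = I.
Proof. intros H Hf; apply is_Cint_unique, is_Cint_ext with f; auto. Qed.

Lemma is_Rint_plus (f g : R -> R) (a b : R) :
  is_Rint f a -> is_Rint g b -> is_Rint (fun t => f t + g t) (a + b).
Proof.
  exact (@is_RInt_gen_plus R_NormedModule _ _ at_right_0_filter
    p_infty_filter f g a b).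
Qed.

Lemma is_Rint_minus (f g : R -> R) (a b : R) :
  is_Rint f a -> is_Rint g b -> is_Rint (fun t => f t - g t) (a - b).
Proof.
  exact (@is_RInt_gen_minus R_NormedModule _ _ at_right_0_filter
    p_infty_filter f g a b).
Qed.

Lemma is_Rint_scal (f : R -> R) (k a : R) :
  is_Rint f a -> is_Rint (fun t => k * f t) (k * a).
Proof.
  exact (@is_RInt_gen_scal R_NormedModule _ _ at_right_0_filter
    p_infty_filter f k a).
Qed.

Lemma is_Cint_plus (f g : R -> C) (a b : C) :
  is_Cint f a -> is_Cint g b -> is_Cint (fun t => f t + g t)%C (a + b)%C.
Proof.
  rewrite !is_Cint_components; intros [H1 H2] [H3 H4]; split;
    apply is_Rint_plus; auto.
Qed.

Lemma is_Cint_scal (c : C) (f : R -> C) (I : C) :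
  is_Cint f I -> is_Cint (fun t => c * f t)%C (c * I)%C.
Proof.
  rewrite !is_Cint_components; intros [H1 H2]; split; simpl.
  - apply is_Rint_minus; apply is_Rint_scal; auto.
  - apply is_Rint_plus; apply is_Rint_scal; auto.
Qed.

Lemma is_Cint_RtoC (f : R -> R) (l : R) :
  is_Rint f l -> is_Cint (fun t => RtoC (f t)) (RtoC l).
Proof.
  intros H; apply is_Cint_components; split; simpl; [exact H|].
  assert (K := is_Rint_scal f 0 l H); rewrite Rmult_0_l in K.
  apply is_Rint_ext with (2 := K); intros; apply Rmult_0_l.
Qed.

Lemma is_Cint_Cmod_le (f : R -> C) (g : R -> R) (I : C) (l : R) :
  (forall t, 0 < t -> Cmod (f t) <= g t) ->
  is_Cint f I -> is_Rint g l -> Cmod I <= l.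
Proof.
  intros H Hf Hg.
  assert (K : norm (I : C_R_CompleteNormedModule) <= l).
  { apply (@RInt_gen_norm C_R_CompleteNormedModule _ _ (at_right_proper_filter 0)
      (Rbar_locally_filter p_infty) f g).
    - generalize half_line_le; apply filter_imp; intros; lra.
    - generalize half_line_le; apply filter_imp; intros [a b] Hab x Hx; simpl in *.
      replace (norm (f x : C_R_CompleteNormedModule)) with (Cmod (f x)); [apply H; lra|].
      apply Cmod_norm.
    - exact Hf.
    - exact Hg. }
  rewrite Cmod_norm; exact K.
Qed.

Definition Euler_kernel (z : C) (t : R) : C :=
  (RtoC (exp (- t)) * Cexp ((z - 1) * RtoC (ln t)))%C.

Lemma Euler_kernel_Re (z : C) (t : R) :
  Re (Euler_kernel z t) = exp (- t) * (exp ((Re z - 1) * ln t) * cos (Im z * ln t)).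
Proof.
  destruct z as [x y]; unfold Euler_kernel, Cexp; simpl.
  replace ((x + - (1)) * ln t - (y + - 0) * 0) with ((x - 1) * ln t) by ring.
  replace ((x + - (1)) * 0 + (y + - 0) * ln t) with (y * ln t) by ring. ring.
Qed.

Lemma Euler_kernel_Im (z : C) (t : R) :
  Im (Euler_kernel z t) = exp (- t) * (exp ((Re z - 1) * ln t) * sin (Im z * ln t)).
Proof.
  destruct z as [x y]; unfold Euler_kernel, Cexp; simpl.
  replace ((x + - (1)) * ln t - (y + - 0) * 0) with ((x - 1) * ln t) by ring.
  replace ((x + - (1)) * 0 + (y + - 0) * ln t) with (y * ln t) by ring. ring.
Qed.

(** Apply [ln v <= v] to [v = t / (2 y + 1)] and use [y / (2 y + 1) <= 1/2]. The summand 1 keeps the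
    divisor positive at [y = 0]. Half of the exponent [- t] thus survives after [t^y] is
    absorbed. *)
Lemma mult_ln_le (y t : R) : 0 <= y -> 0 < t -> y * ln t <= t / 2 + y * ln (2 * y + 1).
Proof.
  intros Hy Ht.
  assert (H : ln (t / (2 * y + 1)) <= t / (2 * y + 1)).
  { assert (P : 0 < t / (2 * y + 1)) by (apply Rdiv_lt_0_compat; lra).
    generalize (exp_ineq1_le (ln (t / (2 * y + 1)))); rewrite exp_ln by exact P; lra. }
  rewrite ln_div in H by lra.
  assert (K : y * (t / (2 * y + 1)) <= t / 2).
  { apply Rmult_le_reg_r with (2 * (2 * y + 1)); [lra|]; field_simplify; nra. }
  nra.
Qed.

Lemma exp_power_le (y t : R) : 0 <= y -> 0 < t ->
  exp (- t) * exp (y * ln t) <= exp (y * ln (2 * y + 1)) * exp (- t / 2).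
Proof.
  intros Hy Ht; rewrite <- !exp_plus.
  assert (K := mult_ln_le y t Hy Ht).
  destruct (Req_dec (- t + y * ln t) (y * ln (2 * y + 1) + - t / 2)) as [->|N];
    [lra | left; apply exp_increasing; lra].
Qed.

Lemma exp_power_lim_0 (x : R) : 0 < x ->
  filterlim (fun t => exp (- t) * exp (x * ln t)) (at_right 0) (locally 0).
Proof.
  intros Hx.
  apply (filterlim_le_le (fun _ => 0) _ (fun t => exp (x * ln t)) 0).
  - exists (mkposreal 1 Rlt_0_1); intros t _ Ht.
    generalize (exp_pos (- t)), (exp_pos (x * ln t)); intros.
    assert (exp (- t) <= 1) by (rewrite <- exp_0; left; apply exp_increasing; lra).
    nra.
  - apply filterlim_const.
  - apply (filterlim_comp _ _ _ (fun t => x * ln t) exp _ (Rbar_locally m_infty));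
      [|exact is_lim_exp_m].
    apply (filterlim_comp _ _ _ ln (Rmult x) _ (Rbar_locally m_infty)); [exact is_lim_ln_0|].
    replace m_infty with (Rbar_mult x m_infty) at 2; [apply filterlim_Rbar_mult_l|].
    simpl; destruct (Rle_dec 0 x) as [H|H]; [|lra].
    destruct (Rle_lt_or_eq_dec 0 x H); [reflexivity | lra].
Qed.

Lemma exp_power_lim_p_infty (x : R) : 0 < x ->
  filterlim (fun t => exp (- t) * exp (x * ln t)) (Rbar_locally p_infty) (locally 0).
Proof.
  intros Hx; set (K := exp (x * ln (2 * x + 1))).
  apply (filterlim_le_le (fun _ => 0) _ (fun t => K * exp (- t / 2)) 0).
  - exists 0; intros t Ht; split.
    + apply Rmult_le_pos; left; apply exp_pos.
    + apply exp_power_le; lra.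
  - apply filterlim_const.
  - replace (Rbar_locally 0) with (Rbar_locally (Rbar_mult K 0)) by (simpl; rewrite Rmult_0_r; reflexivity).
    apply (is_lim_scal_l (fun t => exp (- t / 2)) K p_infty 0).
    apply (filterlim_comp _ _ _ (fun t => - t / 2) exp _ (Rbar_locally m_infty));
      [|exact is_lim_exp_m].
    intros P [M HM]; exists (- 2 * M); intros y Hy; apply HM; lra.
Qed.

Lemma filterlim_mult_bounded_0 (F : (R -> Prop) -> Prop) (FF : Filter F) (f g : R -> R) :
  (forall t, Rabs (g t) <= 1) ->
  filterlim f F (locally 0) -> filterlim (fun t => f t * g t) F (locally 0).
Proof.
  intros Hg Hf; apply filterlim_locally; intros e.
  generalize (proj1 (filterlim_locally f 0) Hf e); apply filter_imp; intros t.
  unfold ball; simpl; unfold AbsRing_ball, abs, minus, plus, opp; simpl.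
  rewrite !Ropp_0, !Rplus_0_r, Rabs_mult.
  generalize (Hg t) (Rabs_pos (f t)) (Rabs_pos (g t)); nra.
Qed.

Lemma Rabs_cos_le (x : R) : Rabs (cos x) <= 1.
Proof. apply Rabs_le_between, COS_bound. Qed.

Lemma Rabs_sin_le (x : R) : Rabs (sin x) <= 1.
Proof. apply Rabs_le_between, SIN_bound. Qed.

Lemma Euler_kernel_continuous (z : C) (t : R) : 0 < t ->
  continuous (fun t => Re (Euler_kernel z t)) t /\
  continuous (fun t => Im (Euler_kernel z t)) t.
Proof.
  intros Ht; split.
  - apply continuous_ext with (fun t => exp (- t) * (exp ((Re z - 1) * ln t) * cos (Im z * ln t))).
    { intros; symmetry; apply Euler_kernel_Re. }
    apply (ex_derive_continuous (V := R_NormedModule)); auto_derive; auto.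
  - apply continuous_ext with (fun t => exp (- t) * (exp ((Re z - 1) * ln t) * sin (Im z * ln t))).
    { intros; symmetry; apply Euler_kernel_Im. }
    apply (ex_derive_continuous (V := R_NormedModule)); auto_derive; auto.
Qed.

Lemma exp_pred_ln (x t : R) : 0 < t -> exp ((x - 1) * ln t) = exp (x * ln t) / t.
Proof.
  intros Ht; replace ((x - 1) * ln t) with (x * ln t + - ln t) by ring.
  rewrite exp_plus, exp_Ropp, exp_ln; auto.
Qed.

(* The primitive [t^x e^(-t) / x] absorbs the singularity at 0 and leaves the
   integrand [t^x e^(-t) / x], which the exponential dominates. *)
Lemma ex_Rint_Euler (x : R) (f : R -> R) : 0 < x ->
  (forall t, 0 < t -> continuous f t) ->
  (forall t, 0 < t -> Rabs (f t) <= exp (- t) * exp ((x - 1) * ln t)) ->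
  exists l, is_Rint f l.
Proof.
  intros Hx Hc Hf; set (K := exp (x * ln (2 * x + 1))).
  assert (HK : 0 < K) by apply exp_pos.
  apply (ex_Rint_dominated f
    (fun t => exp (- t) * exp (x * ln t) / x - 2 * K / x * exp (- t / 2))
    (fun t => exp (- t) * exp ((x - 1) * ln t)
              + (K * exp (- t / 2) - exp (- t) * exp (x * ln t)) / x)
    (3 * K / x)); auto.
  - intros t Ht; auto_derive; [auto|]; rewrite exp_pred_ln by auto;
    change (- t * / 2) with (- t / 2); field; lra.
  - intros t Ht; apply Rle_trans with (1 := Hf t Ht).
    assert (0 <= (K * exp (- t / 2) - exp (- t) * exp (x * ln t)) / x); [|lra].
    apply Rdiv_le_0_compat; auto; unfold K.
    generalize (exp_power_le x t); lra.
  - intros t Ht.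
    assert (A : 0 <= exp (- t) * exp (x * ln t) / x <= K / x).
    { split; [apply Rdiv_le_0_compat; auto; apply Rmult_le_pos; left; apply exp_pos|].
      apply Rmult_le_compat_r; [left; apply Rinv_0_lt_compat, Hx|].
      apply Rle_trans with (1 := exp_power_le x t (Rlt_le _ _ Hx) Ht); fold K.
      assert (exp (- t / 2) <= 1) by (rewrite <- exp_0; left; apply exp_increasing; lra).
      nra. }
    assert (B : 0 <= 2 * K / x * exp (- t / 2) <= 2 * (K / x)).
    { assert (0 < exp (- t / 2) <= 1).
      { split; [apply exp_pos|]; rewrite <- exp_0; left; apply exp_increasing; lra. }
      assert (0 < K / x) by (apply Rdiv_lt_0_compat; auto).
      replace (2 * K / x) with (2 * (K / x)) by (field; lra). nra. }
    replace (3 * K / x) with (3 * (K / x)) by (field; lra).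
    apply Rabs_le_between; lra.
Qed.

(** [Euler_Gamma] is a value selected by uniqueness, so convergence must be known before anything
    can be computed from it. The oscillating factor [t^(i Im z)] has modulus 1, which reduces both
    parts to the real exponent [Re z]. *)
Lemma Euler_Gamma_correct (z : C) : 0 < Re z -> is_Cint (Euler_kernel z) (Euler_Gamma z).
Proof.
  intros Hz.
  assert (B : forall u g t, Rabs (g t) <= 1 -> Rabs (exp (- t) * (exp u * g t)) <= exp (- t) * exp u).
  { intros u g t Hg; rewrite !Rabs_mult, !(Rabs_pos_eq (exp _)) by (left; apply exp_pos).
    rewrite <- Rmult_assoc; rewrite <- (Rmult_1_r (exp (- t) * exp u)) at 2.
    apply Rmult_le_compat_l; auto; apply Rmult_le_pos; left; apply exp_pos. }
  destruct (ex_Rint_Euler (Re z) (fun t => Re (Euler_kernel z t)) Hz) as [a Ha].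
  { intros t Ht; exact (proj1 (Euler_kernel_continuous z t Ht)). }
  { intros; rewrite Euler_kernel_Re; apply (B _ (fun t => cos (Im z * ln t))), Rabs_cos_le. }
  destruct (ex_Rint_Euler (Re z) (fun t => Im (Euler_kernel z t)) Hz) as [b Hb].
  { intros t Ht; exact (proj2 (Euler_kernel_continuous z t Ht)). }
  { intros; rewrite Euler_kernel_Im; apply (B _ (fun t => sin (Im z * ln t))), Rabs_sin_le. }
  assert (H : is_Cint (Euler_kernel z) (a, b)) by (apply is_Cint_components; auto).
  replace (Euler_Gamma z) with ((a, b) : C); [exact H|].
  symmetry; apply is_Cint_unique, H.
Qed.

(** Integration by parts: [z t^(z-1) e^(-t) - t^z e^(-t)] is the derivative of [t^z e^(-t)], which
    vanishes at both ends. *)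
Lemma Euler_Gamma_succ (z : C) : 0 < Re z -> Euler_Gamma (z + 1) = (z * Euler_Gamma z)%C.
Proof.
  intros Hz; apply is_Cint_unique.
  assert (H := is_Cint_scal z _ _ (Euler_Gamma_correct z Hz)).
  apply (is_Cint_ext (fun t => z * Euler_kernel z t
    + RtoC (-1) * (z * Euler_kernel z t - Euler_kernel (z + 1) t))%C).
  { intros t Ht; change (RtoC (exp (- t)) * Cexp ((z + 1 - 1) * RtoC (ln t)))%C
      with (Euler_kernel (z + 1) t).
    generalize (z * Euler_kernel z t)%C (Euler_kernel (z + 1) t); intros [? ?] [? ?].
    apply injective_projections; simpl; ring. }
  replace (z * Euler_Gamma z)%C with (z * Euler_Gamma z + RtoC (-1) * RtoC 0)%C
    by (apply injective_projections; simpl; ring).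
  apply is_Cint_plus; [exact H|]; apply is_Cint_scal.
  (* With [g] the cosine or the sine of [Im z * ln t], the primitive is the real or the imaginary
     part of [t^z e^(-t)]. *)
  assert (L : forall g, (forall t, Rabs (g t) <= 1) -> forall h,
    (forall t, 0 < t -> is_derive (fun t => exp (- t) * exp (Re z * ln t) * g t) t (h t)) ->
    (forall t, 0 < t -> continuous h t) -> is_Rint h 0).
  { intros g Hg h Hd Hc; replace 0 with (0 - 0) by ring.
    apply is_Rint_derive with (fun t => exp (- t) * exp (Re z * ln t) * g t); auto.
    - apply filterlim_mult_bounded_0; auto; [|apply exp_power_lim_0; auto].
      apply at_right_proper_filter.
    - apply filterlim_mult_bounded_0; auto; [|apply exp_power_lim_p_infty; auto].
      apply Rbar_locally_filter. }
  assert (E1 : forall t, Re (z * Euler_kernel z t - Euler_kernel (z + 1) t)%C =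
     Re z * Re (Euler_kernel z t) - Im z * Im (Euler_kernel z t) - Re (Euler_kernel (z + 1) t))
    by reflexivity.
  assert (E2 : forall t, Im (z * Euler_kernel z t - Euler_kernel (z + 1) t)%C =
     Re z * Im (Euler_kernel z t) + Im z * Re (Euler_kernel z t) - Im (Euler_kernel (z + 1) t))
    by reflexivity.
  assert (S1 : Re (z + 1)%C - 1 = Re z) by (simpl; unfold Re; ring).
  assert (S2 : Im (z + 1)%C = Im z) by (simpl; unfold Im; ring).
  assert (Cz := fun t Ht => proj1 (Euler_kernel_continuous z t Ht)).
  assert (Cz' := fun t Ht => proj2 (Euler_kernel_continuous z t Ht)).
  assert (Cs := fun t Ht => proj1 (Euler_kernel_continuous (z + 1) t Ht)).
  assert (Cs' := fun t Ht => proj2 (Euler_kernel_continuous (z + 1) t Ht)).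
  apply is_Cint_components; split;
    [change (Re (RtoC 0)) with 0 | change (Im (RtoC 0)) with 0].
  - apply (L (fun t => cos (Im z * ln t))); [intros; apply Rabs_cos_le| |].
    + intros t Ht; cbv beta; rewrite E1, !Euler_kernel_Re, Euler_kernel_Im, S1, S2, exp_pred_ln by auto.
      auto_derive; [auto|]; field; lra.
    + intros t Ht; apply (continuous_minus (V := R_NormedModule)); [|apply Cs, Ht].
      apply (continuous_minus (V := R_NormedModule));
        [apply (continuous_scal_r (V := R_NormedModule) (Re z)), Cz, Ht
        |apply (continuous_scal_r (V := R_NormedModule) (Im z)), Cz', Ht].
  - apply (L (fun t => sin (Im z * ln t))); [intros; apply Rabs_sin_le| |].
    + intros t Ht; cbv beta; rewrite E2, !Euler_kernel_Im, Euler_kernel_Re, S1, S2, exp_pred_ln by auto.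
      auto_derive; [auto|]; field; lra.
    + intros t Ht; apply (continuous_minus (V := R_NormedModule)); [|apply Cs', Ht].
      apply (continuous_plus (V := R_NormedModule));
        [apply (continuous_scal_r (V := R_NormedModule) (Re z)), Cz', Ht
        |apply (continuous_scal_r (V := R_NormedModule) (Im z)), Cz, Ht].
Qed.

(** * Moments of the exponential and estimates of powers *)

Lemma Cexp_plus (z w : C) : Cexp (z + w) = (Cexp z * Cexp w)%C.
Proof.
  destruct z as [x y], w as [u v]; unfold Cexp; simpl.
  rewrite exp_plus, cos_plus, sin_plus; apply injective_projections; simpl; ring.
Qed.

Lemma Cexp_RtoC (x : R) : Cexp (RtoC x) = RtoC (exp x).
Proof.
  unfold Cexp; simpl; rewrite cos_0, sin_0; apply injective_projections; simpl; ring.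
Qed.

Lemma Cexp_0 : Cexp 0 = 1.
Proof. rewrite Cexp_RtoC, exp_0; reflexivity. Qed.

Lemma Cexp_neg (z : C) : (Cexp z * Cexp (- z))%C = 1.
Proof. rewrite <- Cexp_plus, Cplus_opp_r; apply Cexp_0. Qed.

Lemma Cexp_neq_0 (z : C) : Cexp z <> 0.
Proof.
  intros H; apply C1_nz; rewrite <- (Cexp_neg z), H; apply injective_projections; simpl; ring.
Qed.

Lemma Euler_Gamma_1 : Euler_Gamma 1 = 1.
Proof.
  apply is_Cint_unique, is_Cint_ext with (fun t => RtoC (exp (- t))).
  - intros t Ht; replace ((1 - 1) * RtoC (ln t))%C with (RtoC 0)
      by (apply injective_projections; simpl; ring).
    rewrite Cexp_0; ring.
  - apply is_Cint_RtoC; assert (H : is_Rint (fun t => exp (- t)) (0 - -1)).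
    { apply is_Rint_derive with (fun t => - exp (- t)).
      - intros t _; auto_derive; [auto | ring].
      - intros t _; apply (ex_derive_continuous (V := R_NormedModule)); auto_derive; auto.
      - assert (K : filterlim (fun t => - exp (- t)) (locally 0) (locally (- exp (- 0)))).
        { apply (ex_derive_continuous (fun t => - exp (- t))); auto_derive; auto. }
        rewrite Ropp_0, exp_0 in K.
        intros P HP; generalize (K P HP); unfold filtermap, at_right, within.
        apply filter_imp; auto.
      - replace 0 with (- 0) by ring.
        apply (filterlim_comp _ _ _ (fun t => exp (- t)) Ropp _ (locally 0));
          [|apply (filterlim_opp (V := R_NormedModule))].
        apply (filterlim_comp _ _ _ Ropp exp _ (Rbar_locally m_infty));
          [|exact is_lim_exp_m].
        intros P [M HM]; exists (- M); intros y Hy; apply HM; lra. }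
    replace (0 - -1) with 1 in H by ring; exact H.
Qed.

Lemma Euler_Gamma_fact (n : nat) : Euler_Gamma (RtoC (INR (S n))) = RtoC (INR (fact n)).
Proof.
  induction n as [|n IH]; [exact Euler_Gamma_1|].
  rewrite (S_INR (S n)), RtoC_plus, Euler_Gamma_succ, IH, <- RtoC_mult.
  - f_equal; change (fact (S n)) with (S n * fact n)%nat; rewrite mult_INR; reflexivity.
  - apply lt_0_INR; lia.
Qed.

Lemma exp_INR_ln (n : nat) (t : R) : 0 < t -> exp (INR n * ln t) = t ^ n.
Proof.
  intros Ht; induction n as [|n IH]; [rewrite Rmult_0_l; apply exp_0|].
  rewrite S_INR, Rmult_plus_distr_r, exp_plus, IH, Rmult_1_l, exp_ln by auto.
  simpl; ring.
Qed.

(** These moments give the exact integral of the Laurent polynomial that majorizes the error in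
    Euler's limit. *)
Lemma is_Rint_exp_pow (n : nat) : is_Rint (fun t => exp (- t) * t ^ n) (INR (fact n)).
Proof.
  assert (H : 0 < Re (INR (S n))) by (apply lt_0_INR; lia).
  apply Euler_Gamma_correct, is_Cint_components in H; destruct H as [H _].
  rewrite Euler_Gamma_fact in H.
  apply is_Rint_ext with (2 := H); intros t Ht; rewrite Euler_kernel_Re, S_INR; simpl.
  replace (INR n + 1 - 1) with (INR n) by ring.
  rewrite Rmult_0_l, cos_0, exp_INR_ln by auto; ring.
Qed.

(** * Elementary inequalities leading to a rational bound on the square of [|u^z - 1|] *)

Lemma Rabs_sin_le_Rabs (x : R) : Rabs (sin x) <= Rabs x.
Proof.
  assert (P : forall x, 0 < x -> Rabs (sin x) <= x).
  { clear x; intros x Hx; apply Rabs_le_between; split; [|left; apply sin_lt_x, Hx].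
    destruct (Rle_lt_dec x 1) as [H|H]; [|generalize (SIN_bound x); lra].
    generalize (sin_ge_0 x), PI2_1; lra. }
  destruct (Rtotal_order x 0) as [H|[->|H]].
  - rewrite <- (Rabs_Ropp (sin x)), <- sin_neg, (Rabs_left x) by lra; apply P; lra.
  - rewrite sin_0; lra.
  - rewrite (Rabs_pos_eq x) by lra; apply P, H.
Qed.

Lemma one_minus_cos_le (x : R) : 1 - cos x <= x * x / 2.
Proof.
  replace x with (2 * (x / 2)) at 1 by field; rewrite cos_2a_sin.
  assert (H := Rabs_sin_le_Rabs (x / 2)); apply Rsqr_le_abs_1 in H; unfold Rsqr in H; lra.
Qed.

Lemma sinh_ge (w : R) : 0 <= w -> 2 * w <= exp w - exp (- w).
Proof.
  intros Hw.
  destruct (MVT_gen (fun w => exp w - exp (- w)) 0 w (fun w => exp w + exp (- w))) as [c [_ E]].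
  - intros x _; auto_derive; [auto | ring].
  - intros x _; apply continuity_pt_filterlim.
    apply (ex_derive_continuous (fun w => exp w - exp (- w))); auto_derive; auto.
  - rewrite Ropp_0, exp_0 in E.
    assert (P : exp c * exp (- c) = 1) by (rewrite <- exp_plus, Rplus_opp_r, exp_0; reflexivity).
    generalize (exp_pos c), (exp_pos (- c)); intros.
    assert (2 <= exp c + exp (- c))
      by (generalize (Rle_0_sqr (exp c - exp (- c))); unfold Rsqr; nra).
    assert (0 <= (exp c + exp (- c) - 2) * w) by (apply Rmult_le_pos; lra). lra.
Qed.

(** With [u = e^(2w)] the right side is [(e^w - e^(-w))^2], and [sinh_ge] bounds [2 |w|] by
    [|e^w - e^(-w)|]. This replaces the logarithm by powers of [u], whose moments are factorials. *)
Lemma ln_sqr_le (u : R) : 0 < u -> ln u * ln u <= u - 2 + / u.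
Proof.
  intros Hu; set (w := ln u / 2).
  assert (E : exp w * exp w = u).
  { rewrite <- exp_plus; replace (w + w) with (ln u) by (unfold w; field); apply exp_ln, Hu. }
  assert (P : exp w * exp (- w) = 1) by (rewrite <- exp_plus, Rplus_opp_r, exp_0; reflexivity).
  generalize (exp_pos w), (exp_pos (- w)); intros P1 P2.
  assert (E' : exp (- w) * exp (- w) = / u).
  { apply Rmult_eq_reg_l with u; [|lra]; rewrite Rinv_r, <- E by lra.
    replace 1 with ((exp w * exp (- w)) * (exp w * exp (- w))) by (rewrite P; ring); ring. }
  replace (u - 2 + / u) with ((exp w - exp (- w)) * (exp w - exp (- w))).
  2: { rewrite <- E', <- E at 1; nra. }
  replace (ln u) with (2 * w) by (unfold w; field).
  destruct (Rle_lt_dec 0 w) as [H|H].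
  - generalize (sinh_ge w H); nra.
  - assert (K := sinh_ge (- w)); rewrite Ropp_involutive in K; nra.
Qed.

(** With [u^z = e^(a + i b)], the square is [(e^a - 1)^2 + 2 e^a (1 - cos b)]. The restriction on
    [Re z] puts [e^a] between 1 and [u], so the first term is at most [(u - 1)^2]; the second is
    controlled by [ln_sqr_le]. *)
Lemma Cexp_mult_ln_sqr_le (z : C) (u : R) : 0 < u -> 0 <= Re z <= 1 ->
  Cmod (Cexp (z * RtoC (ln u)) - 1) ^ 2
  <= (1 + Im z * Im z) * (2 * (u * u) - 3 * u + / u).
Proof.
  intros Hu Hx; destruct z as [x y]; simpl in Hx.
  replace ((x, y) * RtoC (ln u))%C with (x * ln u, y * ln u)
    by (apply injective_projections; simpl; ring).
  set (a := x * ln u); set (b := y * ln u).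
  assert (S : Cmod (Cexp (a, b) - 1) ^ 2 = (exp a - 1) * (exp a - 1) + 2 * exp a * (1 - cos b)).
  { unfold Cmod; rewrite <- Rsqr_pow2, Rsqr_sqrt.
    2: { apply Rplus_le_le_0_compat; apply pow2_ge_0. }
    unfold Cexp; simpl; generalize (sin2_cos2 b); unfold Rsqr; intros T.
    transitivity (exp a * exp a * (sin b * sin b + cos b * cos b) - 2 * exp a * cos b + 1);
      [ring|]; rewrite T; ring. }
  rewrite S; clear S.
  assert (B : 1 - cos b <= y * y * (u - 2 + / u) / 2).
  { apply Rle_trans with (1 := one_minus_cos_le b); unfold b.
    generalize (ln_sqr_le u Hu), (Rle_0_sqr y); unfold Rsqr; nra. }
  assert (M : forall p q, p <= q -> exp p <= exp q).
  { intros p q [H| ->]; [left; apply exp_increasing, H | right; reflexivity]. }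
  assert (A : 1 <= exp a <= u \/ u <= exp a <= 1).
  { rewrite <- exp_0; rewrite <- (exp_ln u Hu).
    destruct (Rle_lt_dec 1 u) as [H|H].
    - left; assert (0 <= ln u) by (rewrite <- ln_1; apply ln_le; lra).
      split; apply M; unfold a; nra.
    - right; assert (ln u < 0) by (rewrite <- ln_1; apply ln_increasing; lra).
      split; apply M; unfold a; nra. }
  assert (A1 : (exp a - 1) * (exp a - 1) <= (u - 1) * (u - 1)) by (destruct A; nra).
  assert (A2 : 0 < exp a <= 1 + u) by (split; [apply exp_pos | destruct A; lra]).
  assert (V : 0 < / u) by (apply Rinv_0_lt_compat, Hu).
  assert (D : 0 <= u - 2 + / u).
  { replace (u - 2 + / u) with ((u - 1) * (u - 1) * / u) by (field; lra).
    apply Rmult_le_pos; [apply Rle_0_sqr | lra]. }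
  assert (C0 : 0 <= 1 - cos b) by (generalize (COS_bound b); lra).
  assert (Y : 0 <= y * y) by apply Rle_0_sqr.
  assert (F : 2 * exp a * (1 - cos b) <= (1 + u) * (y * y * (u - 2 + / u))).
  { apply Rle_trans with (2 * exp a * (y * y * (u - 2 + / u) / 2)).
    - apply Rmult_le_compat_l; lra.
    - replace (2 * exp a * (y * y * (u - 2 + / u) / 2)) with (exp a * (y * y * (u - 2 + / u)))
        by (field; lra).
      apply Rmult_le_compat_r; [apply Rmult_le_pos; assumption | apply A2]. }
  (* This splitting shows the origin of the polynomial: [(u - 1)^2] bounds the radial part and
     [(1 + u) (u - 2 + 1/u)], weighted by [y^2], the angular part; the factor [1 + y^2] covers
     both. *)
  replace (2 * (u * u) - 3 * u + / u) with ((u - 1) * (u - 1) + (1 + u) * (u - 2 + / u)) by (field; lra).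
  simpl.
  assert (0 <= (1 + u) * (u - 2 + / u)) by (apply Rmult_le_pos; lra).
  assert (0 <= y * y * ((u - 1) * (u - 1))) by (apply Rmult_le_pos; [exact Y | apply Rle_0_sqr]).
  lra.
Qed.

(** * Euler's limit *)

(** Stated through the real sequence of distances, so that the real squeeze, shift and subsequence
    lemmas apply as they are. *)
Definition is_Clim_seq (u : nat -> C) (l : C) : Prop :=
  is_lim_seq (fun n => Cmod (u n - l)) 0.

Lemma is_Clim_seq_le (u : nat -> C) (l : C) (b : nat -> R) :
  (forall n, Cmod (u n - l) <= b n) -> is_lim_seq b 0 -> is_Clim_seq u l.
Proof.
  intros H Hb; apply is_lim_seq_le_le with (fun _ => 0) b; auto.
  - intros n; split; [apply Cmod_ge_0 | apply H].
  - apply is_lim_seq_const.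
Qed.

Lemma is_Clim_seq_unique (u : nat -> C) (l l' : C) :
  is_Clim_seq u l -> is_Clim_seq u l' -> l = l'.
Proof.
  intros H H'.
  assert (K : is_lim_seq (fun n => Cmod (u n - l) + Cmod (u n - l')) 0).
  { replace (Finite 0) with (Finite (0 + 0)) by (f_equal; ring).
    apply is_lim_seq_plus'; assumption. }
  assert (M : Cmod (l - l') <= 0).
  { apply (is_lim_seq_le (fun _ => Cmod (l - l')) _ (Cmod (l - l')) 0) with (3 := K).
    - intros n; replace (l - l')%C with ((u n - l') - (u n - l))%C by ring.
      eapply Rle_trans; [apply Cmod_triangle|]; rewrite Cmod_opp; lra.
    - apply is_lim_seq_const. }
  assert (Z : (l - l')%C = 0) by (apply Cmod_eq_0; generalize (Cmod_ge_0 (l - l')); lra).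
  replace l with ((l - l') + l')%C by ring; rewrite Z; ring.
Qed.

Lemma is_Clim_seq_mult (u v : nat -> C) (l m : C) :
  is_Clim_seq u l -> is_Clim_seq v m -> is_Clim_seq (fun n => u n * v n)%C (l * m)%C.
Proof.
  intros Hu Hv.
  apply is_Clim_seq_le with (fun n => Cmod (u n - l) * Cmod (v n - m)
    + (Cmod l * Cmod (v n - m) + Cmod m * Cmod (u n - l))).
  - intros n; replace (u n * v n - l * m)%C
      with ((u n - l) * (v n - m) + (l * (v n - m) + m * (u n - l)))%C by ring.
    eapply Rle_trans; [apply Cmod_triangle|].
    rewrite <- !Cmod_mult; apply Rplus_le_compat_l, Cmod_triangle.
  - replace (Finite 0) with (Finite (0 * 0 + (Cmod l * 0 + Cmod m * 0))) by (f_equal; ring).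
    repeat apply is_lim_seq_plus'; apply is_lim_seq_mult'; auto; apply is_lim_seq_const.
Qed.

Lemma is_Clim_seq_ext (u v : nat -> C) (l : C) :
  (forall n, u n = v n) -> is_Clim_seq u l -> is_Clim_seq v l.
Proof. intros H; apply is_lim_seq_ext; intros n; rewrite H; reflexivity. Qed.

Lemma is_Clim_seq_const (c : C) : is_Clim_seq (fun _ => c) c.
Proof.
  apply is_lim_seq_ext with (fun _ => 0); [|apply is_lim_seq_const].
  intros n; replace (c - c)%C with (RtoC 0) by ring; rewrite Cmod_0; reflexivity.
Qed.

Lemma is_Clim_seq_RtoC (u : nat -> R) (l : R) :
  is_lim_seq u l -> is_Clim_seq (fun n => RtoC (u n)) (RtoC l).
Proof.
  intros H; apply is_lim_seq_ext with (fun n => Rabs (u n - l)).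
  - intros n; rewrite <- RtoC_minus, Cmod_R; reflexivity.
  - replace (Finite 0) with (Rbar_abs (Finite (l - l))) by (simpl; rewrite Rminus_diag, Rabs_R0; reflexivity).
    apply is_lim_seq_abs, is_lim_seq_minus'; [exact H | apply is_lim_seq_const].
Qed.

(** Euler's limit: [Gamma (z + n) ~ (n - 1)! n^z], here with [n] replaced by [n + 1]. *)
Definition Gamma_ratio (z : C) (n : nat) : C :=
  (Euler_Gamma (z + RtoC (INR (S n))) * Cexp (- (z * RtoC (ln (INR (S n)))))
     / RtoC (INR (fact n)))%C.

Lemma RtoC_m1 : RtoC (-1) = (- (1))%C.
Proof. apply injective_projections; simpl; ring. Qed.

Lemma RtoC_fact_neq_0 (n : nat) : RtoC (INR (fact n)) <> 0.
Proof. intros H; apply (INR_fact_neq_0 n), RtoC_inj, H. Qed.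

(** Isolates the weight [t^n e^(-t)] from the power of [u = t / c] that is to be compared with 1. *)
Lemma Euler_kernel_shift (z : C) (n : nat) (t c : R) : 0 < t -> 0 < c ->
  (Cexp (- (z * RtoC (ln c))) * Euler_kernel (z + RtoC (INR (S n))) t)%C
  = (RtoC (exp (- t) * t ^ n) * Cexp (z * RtoC (ln (t / c))))%C.
Proof.
  intros Ht Hc; unfold Euler_kernel.
  replace ((z + RtoC (INR (S n)) - 1) * RtoC (ln t))%C
    with (z * RtoC (ln t) + RtoC (INR n * ln t))%C
    by (rewrite S_INR, RtoC_plus, RtoC_mult; ring).
  rewrite Cexp_plus, Cexp_RtoC, exp_INR_ln by auto.
  rewrite ln_div, RtoC_minus by auto.
  replace (z * (RtoC (ln t) - RtoC (ln c)))%C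
    with (z * RtoC (ln t) + - (z * RtoC (ln c)))%C by ring.
  rewrite Cexp_plus, RtoC_mult; ring.
Qed.

(* With [u = t / N], AM-GM bounds [|u^z - 1|] by [d/2 + |u^z - 1|^2 / (2d)], and
   the square by a Laurent polynomial in [u] whose integral against the weight
   [t^(N-1) e^(-t)] is [O(1/N)]. *)
Lemma Gamma_ratio_bound (z : C) (d : R) (k : nat) : 0 < d -> 0 < Re z <= 1 ->
  Cmod (Gamma_ratio z (S k) - 1)
  <= d / 2 + 3 * (1 + Im z * Im z) / (2 * d) * / INR (S k).
Proof.
  intros Hd Hz; set (N := INR (S (S k))); set (Y := 1 + Im z * Im z).
  assert (HN : 0 < N) by (apply lt_0_INR; lia).
  assert (HY : 0 < Y) by (unfold Y; generalize (Rle_0_sqr (Im z)); unfold Rsqr; lra).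
  assert (HE : is_Cint (Euler_kernel (z + RtoC N)) (Euler_Gamma (z + RtoC N))).
  { apply Euler_Gamma_correct; simpl; fold N; unfold Re in *; lra. }
  apply (is_Cint_scal (Cexp (- (z * RtoC (ln N))))) in HE.
  assert (H1 := is_Cint_scal (RtoC (-1)) _ _ (is_Cint_RtoC _ _ (is_Rint_exp_pow (S k)))).
  assert (H := is_Cint_plus _ _ _ _ HE H1); clear HE H1.
  set (w := fun n t => exp (- t) * t ^ n).
  (* The weight [w (S k)] times [2 u^2], [-3 u] and [1/u], with [u = t / N]. The factor [1/u] lowers
     the exponent to [k], which is why the estimate is made at index [S k]. *)
  assert (HR : is_Rint (fun t => d / 2 * w (S k) t
      + Y / (2 * d) * (2 / (N * N) * w (S (S (S k))) t - 3 / N * w (S (S k)) t + N * w k t))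
    (d / 2 * INR (fact (S k)) + Y / (2 * d) * (2 / (N * N) * INR (fact (S (S (S k))))
      - 3 / N * INR (fact (S (S k))) + N * INR (fact k)))).
  { apply is_Rint_plus; [apply is_Rint_scal, is_Rint_exp_pow|].
    apply is_Rint_scal; apply is_Rint_plus; [apply is_Rint_minus|];
      apply is_Rint_scal, is_Rint_exp_pow. }
  assert (B := fun P => is_Cint_Cmod_le _ _ _ _ P H HR); clear H HR.
  assert (F : RtoC (INR (fact (S k))) <> 0) by apply RtoC_fact_neq_0.
  assert (F' : 0 < INR (fact (S k))) by apply INR_fact_lt_0.
  apply Rmult_le_reg_l with (INR (fact (S k))); [exact F'|].
  replace (INR (fact (S k)) * Cmod (Gamma_ratio z (S k) - 1))
    with (Cmod (Cexp (- (z * RtoC (ln N))) * Euler_Gamma (z + RtoC N)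
                + RtoC (-1) * RtoC (INR (fact (S k))))).
  2: { rewrite <- (Rabs_pos_eq (INR (fact (S k)))) at 2 by lra.
    rewrite <- Cmod_R, <- Cmod_mult; f_equal; unfold Gamma_ratio; fold N.
    rewrite RtoC_m1; field; exact F. }
  eapply Rle_trans; [apply B|]; clear B.
  - intros t Ht; unfold N at 1 2; rewrite Euler_kernel_shift by auto; fold N.
    replace (RtoC (exp (- t) * t ^ S k) * Cexp (z * RtoC (ln (t / N)))
             + RtoC (-1) * RtoC (exp (- t) * t ^ S k))%C
      with (RtoC (w (S k) t) * (Cexp (z * RtoC (ln (t / N))) - 1))%C
      by (unfold w; rewrite RtoC_m1; ring).
    assert (W : 0 < w k t) by (apply Rmult_lt_0_compat; [apply exp_pos | apply pow_lt, Ht]).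
    rewrite Cmod_mult, Cmod_R.
    assert (Hu : 0 < t / N) by (apply Rdiv_lt_0_compat; auto).
    assert (K := Cexp_mult_ln_sqr_le z (t / N) Hu); fold Y in K.
    set (h := Cmod (Cexp (z * RtoC (ln (t / N))) - 1)) in *.
    assert (A : h <= d / 2 + h ^ 2 / (2 * d)).
    { apply Rmult_le_reg_l with (2 * d); [lra|].
      replace (2 * d * (d / 2 + h ^ 2 / (2 * d))) with (d * d + h * h) by (field; lra).
      generalize (Rle_0_sqr (d - h)); unfold Rsqr; lra. }
    assert (A2 : h ^ 2 / (2 * d) <= Y * (2 * (t / N * (t / N)) - 3 * (t / N) + / (t / N)) / (2 * d)).
    { apply Rmult_le_compat_r; [left; apply Rinv_0_lt_compat; lra | apply K; lra]. }
    assert (E1 : w (S k) t = t * w k t) by (unfold w; simpl; ring).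
    assert (E2 : w (S (S k)) t = t * t * w k t) by (unfold w; simpl; ring).
    assert (E3 : w (S (S (S k))) t = t * t * t * w k t) by (unfold w; simpl; ring).
    rewrite E1, E2, E3, Rabs_pos_eq by (apply Rmult_le_pos; lra).
    apply Rle_trans with (t * w k t *
      (d / 2 + Y * (2 * (t / N * (t / N)) - 3 * (t / N) + / (t / N)) / (2 * d))).
    + apply Rmult_le_compat_l; [apply Rmult_le_pos; lra | lra].
    + right; field; repeat split; lra.
  - assert (G : forall m, INR (fact (S m)) = INR (S m) * INR (fact m))
      by (intros m; rewrite <- mult_INR; reflexivity).
    rewrite (G (S (S k))), (G (S k)), (G k).
    assert (Hk : 0 < INR (S k)) by (apply lt_0_INR; lia).
    assert (N1 : N = INR (S k) + 1) by (unfold N; rewrite S_INR; reflexivity).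
    assert (N2 : INR (S (S (S k))) = INR (S k) + 2) by (rewrite !S_INR; ring).
    fold N; rewrite N2, N1; set (x := INR (S k)) in *.
    assert (Ff : 0 < INR (fact k)) by apply INR_fact_lt_0.
    set (f := INR (fact k)) in *.
    replace (x * f * (d / 2 + 3 * Y / (2 * d) * / x)) with (d / 2 * (x * f) + Y / (2 * d) * (3 * f))
      by (field; lra).
    apply Rplus_le_compat_l, Rmult_le_compat_l; [left; apply Rdiv_lt_0_compat; lra|].
    (* Because [2 - 3 + 1 = 0], the terms of order [x f] cancel. At most [3 f] remains, which is
       [3 / x] relative to the total mass [x f] of the weight. *)
    assert (X : 2 / ((x + 1) * (x + 1)) * ((x + 2) * ((x + 1) * (x * f)))
      - 3 / (x + 1) * ((x + 1) * (x * f)) + (x + 1) * f = 3 * f - 2 * f / (x + 1))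
      by (field; lra).
    rewrite X; assert (0 < 2 * f / (x + 1)) by (apply Rdiv_lt_0_compat; lra). lra.
Qed.

Lemma is_lim_seq_inv_INR_S : is_lim_seq (fun n => / INR (S n)) 0.
Proof.
  apply (is_lim_seq_incr_1 (fun n => / INR n)).
  replace (Finite 0) with (Rbar_inv p_infty) by reflexivity.
  apply is_lim_seq_inv; [apply is_lim_seq_INR | discriminate].
Qed.

(** The free parameter [d] of the bound is set to the tolerance [e]: the constant part is then
    [e / 2], and for this fixed [d] the rest tends to 0. *)
Lemma Gamma_ratio_lim_strip (z : C) : 0 < Re z <= 1 -> is_Clim_seq (Gamma_ratio z) 1.
Proof.
  intros Hz; apply is_lim_seq_incr_1.
  apply (proj1 (is_lim_seq_spec _ (Finite 0))); intros e.
  set (c := 3 * (1 + Im z * Im z) / (2 * e)).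
  assert (L : is_lim_seq (fun k => c * / INR (S k)) 0).
  { replace (Finite 0) with (Finite (c * 0)) by (f_equal; ring).
    apply is_lim_seq_mult'; [apply is_lim_seq_const | apply is_lim_seq_inv_INR_S]. }
  destruct (proj2 (is_lim_seq_spec _ (Finite 0)) L (pos_div_2 e)) as [m Hm].
  exists m; intros n Hn; specialize (Hm n Hn); change (pos (pos_div_2 e)) with (e / 2) in Hm.
  rewrite Rminus_0_r in *; rewrite Rabs_pos_eq by apply Cmod_ge_0.
  apply Rabs_def2 in Hm.
  eapply Rle_lt_trans; [apply (Gamma_ratio_bound z e n (cond_pos e) Hz)|].
  fold c; lra.
Qed.

Lemma Gamma_ratio_succ (z : C) (n : nat) : 0 < Re z ->
  Gamma_ratio (z + 1) n = ((1 + z * RtoC (/ INR (S n))) * Gamma_ratio z n)%C.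
Proof.
  intros Hz; unfold Gamma_ratio.
  assert (HN : 0 < INR (S n)) by (apply lt_0_INR; lia).
  assert (HN' : RtoC (INR (S n)) <> 0) by (intros H; apply RtoC_inj in H; lra).
  replace (z + 1 + RtoC (INR (S n)))%C with (z + RtoC (INR (S n)) + 1)%C by ring.
  rewrite Euler_Gamma_succ by (rewrite re_plus, re_RtoC; lra).
  replace (- ((z + 1) * RtoC (ln (INR (S n)))))%C
    with (- (z * RtoC (ln (INR (S n)))) + RtoC (- ln (INR (S n))))%C
    by (rewrite RtoC_opp; ring).
  rewrite Cexp_plus, Cexp_RtoC, exp_Ropp, exp_ln, RtoC_inv by lra.
  field; split; [apply RtoC_fact_neq_0 | exact HN'].
Qed.

(** Induction on an integer above [Re z]: outside the strip, passing from [z - 1] to [z] multiplies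
    the ratio by [1 + (z - 1) / (n + 1)], which tends to 1. *)
Lemma Gamma_ratio_lim (z : C) : 0 < Re z -> is_Clim_seq (Gamma_ratio z) 1.
Proof.
  intros Hz; destruct (INR_unbounded (Re z)) as [m Hm].
  revert z Hz Hm; induction m as [|m IH]; intros z Hz Hm; [simpl in Hm; lra|].
  destruct (Rle_lt_dec (Re z) 1) as [H|H]; [apply Gamma_ratio_lim_strip; lra|].
  assert (Hz' : 0 < Re (z - 1)%C) by (simpl; unfold Re in H; lra).
  apply is_Clim_seq_ext with
    (fun n => (1 + (z - 1) * RtoC (/ INR (S n))) * Gamma_ratio (z - 1) n)%C.
  { intros n; rewrite <- Gamma_ratio_succ by exact Hz'.
    replace (z - 1 + 1)%C with z by ring; reflexivity. }
  assert (M := is_Clim_seq_mult (fun n => 1 + (z - 1) * RtoC (/ INR (S n)))%C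
    (Gamma_ratio (z - 1)) 1 1).
  rewrite Cmult_1_r in M; apply M; clear M.
  - apply is_Clim_seq_le with (fun n => Cmod (z - 1) * / INR (S n)).
    + intros n; rewrite <- (Rabs_pos_eq (/ INR (S n))) at 1.
      2: { left; apply Rinv_0_lt_compat, lt_0_INR; lia. }
      replace (1 + (z - 1) * RtoC (Rabs (/ INR (S n))) - 1)%C
        with ((z - 1) * RtoC (Rabs (/ INR (S n))))%C by ring.
      rewrite Cmod_mult, Cmod_R, Rabs_Rabsolu, Rabs_pos_eq; [right; reflexivity|].
      left; apply Rinv_0_lt_compat, lt_0_INR; lia.
    + replace (Finite 0) with (Finite (Cmod (z - 1) * 0)) by (f_equal; ring).
      apply is_lim_seq_mult'; [apply is_lim_seq_const | apply is_lim_seq_inv_INR_S].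
  - apply IH; [exact Hz'|]; rewrite S_INR in Hm; simpl; unfold Re in *; lra.
Qed.

(** By the recurrence a zero at [z] spreads to all [z + n], and [Gamma_ratio z] would be identically
    0 while tending to 1. *)
Lemma Euler_Gamma_neq_0 (z : C) : 0 < Re z -> Euler_Gamma z <> 0.
Proof.
  intros Hz H.
  assert (Z : forall n, Euler_Gamma (z + RtoC (INR n)) = 0).
  { induction n as [|n IH].
    - simpl; rewrite Cplus_0_r; exact H.
    - rewrite S_INR, RtoC_plus, Cplus_assoc, Euler_Gamma_succ, IH; [ring|].
      generalize (pos_INR n); rewrite re_plus, re_RtoC; lra. }
  apply C1_nz, (is_Clim_seq_unique (Gamma_ratio z)); [apply Gamma_ratio_lim, Hz|].
  apply is_Clim_seq_ext with (fun _ => RtoC 0); [|apply is_Clim_seq_const].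
  intros n; unfold Gamma_ratio; rewrite Z; field; apply RtoC_fact_neq_0.
Qed.

(** * Wallis' product and the duplication formula *)

Definition Wallis_int (n : nat) : R := RInt (fun x => sin x ^ n) 0 (PI / 2).

Lemma ex_RInt_sin_pow (n : nat) : ex_RInt (fun x => sin x ^ n) 0 (PI / 2).
Proof.
  apply (ex_RInt_continuous (V := R_CompleteNormedModule)); intros x _.
  apply (ex_derive_continuous (fun x => sin x ^ n)); auto_derive; auto.
Qed.

Lemma Wallis_int_0 : Wallis_int 0 = PI / 2.
Proof.
  unfold Wallis_int; simpl.
  rewrite RInt_const; unfold scal; simpl; unfold mult; simpl; ring.
Qed.

Lemma Wallis_int_1 : Wallis_int 1 = 1.
Proof.
  assert (H : is_RInt (fun x => sin x ^ 1) 0 (PI / 2) (minus (- cos (PI / 2)) (- cos 0))).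
  { apply (is_RInt_derive (V := R_CompleteNormedModule) (fun x => - cos x)).
    - intros x _; auto_derive; [auto | ring].
    - intros x _; apply (ex_derive_continuous (fun x => sin x ^ 1)); auto_derive; auto. }
  rewrite cos_PI2, cos_0 in H; unfold Wallis_int; rewrite (is_RInt_unique _ _ _ _ H).
  unfold minus, plus, opp; simpl; ring.
Qed.

(** The derivative of [sin^(n+1) cos] is [(n+1) sin^n - (n+2) sin^(n+2)], and this primitive
    vanishes at 0 and at [PI / 2]. *)
Lemma Wallis_int_SS (n : nat) :
  INR (S (S n)) * Wallis_int (S (S n)) = INR (S n) * Wallis_int n.
Proof.
  assert (H : is_RInt (fun x => INR (S n) * sin x ^ n - INR (S (S n)) * sin x ^ S (S n)) 0 (PI / 2)
    (minus (sin (PI / 2) ^ S n * cos (PI / 2)) (sin 0 ^ S n * cos 0))).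
  { apply (is_RInt_derive (V := R_CompleteNormedModule) (fun x => sin x ^ S n * cos x)).
    - intros x _; auto_derive; [auto|].
      assert (T := sin2_cos2 x); unfold Rsqr in T.
      change (Init.Nat.pred (S n)) with n.
      change (match n with 0%nat => 1 | S _ => INR n + 1 end) with (INR (S n)).
      rewrite (S_INR (S n)); simpl pow.
      transitivity (INR (S n) * sin x ^ n * (cos x * cos x) - sin x ^ n * (sin x * sin x)); [ring|].
      replace (cos x * cos x) with (1 - sin x * sin x) by lra; ring.
    - intros x _; apply (ex_derive_continuous (fun x => INR (S n) * sin x ^ n - INR (S (S n)) * sin x ^ S (S n))).
      auto_derive; auto. }
  assert (I := fun k => RInt_correct (V := R_CompleteNormedModule) _ _ _ (ex_RInt_sin_pow k)).
  assert (K : is_RInt (fun x => INR (S n) * sin x ^ n - INR (S (S n)) * sin x ^ S (S n)) 0 (PI / 2)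
    (INR (S n) * Wallis_int n - INR (S (S n)) * Wallis_int (S (S n)))).
  { exact (is_RInt_minus (V := R_NormedModule) _ _ _ _ _ _
      (is_RInt_scal (V := R_NormedModule) _ _ _ (INR (S n)) _ (I n))
      (is_RInt_scal (V := R_NormedModule) _ _ _ (INR (S (S n))) _ (I (S (S n))))). }
  assert (Q := eq_trans (eq_sym (is_RInt_unique (V := R_CompleteNormedModule) _ _ _ _ K))
    (is_RInt_unique (V := R_CompleteNormedModule) _ _ _ _ H)).
  rewrite cos_PI2, sin_0 in Q; unfold minus, plus, opp in Q; simpl AbelianGroup.sort in Q.
  change (INR (S n) * Wallis_int n - INR (S (S n)) * Wallis_int (S (S n))
    = sin (PI / 2) ^ S n * 0 + - (0 ^ S n * cos 0)) in Q.
  rewrite pow_i in Q by lia; lra.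
Qed.

Lemma Wallis_int_decr (n : nat) : Wallis_int (S n) <= Wallis_int n.
Proof.
  apply RInt_le; try apply ex_RInt_sin_pow; [generalize PI_RGT_0; lra|].
  intros x Hx; simpl.
  assert (0 <= sin x) by (apply sin_ge_0; generalize PI_RGT_0; lra).
  generalize (SIN_bound x), (pow_le (sin x) n); nra.
Qed.

(** Equal to [2 4 ... (2n) / (1 3 ... (2n-1))], that is [4^n] over the central binomial
    coefficient. *)
Definition Wallis_prod (n : nat) : R := 4 ^ n * INR (fact n) ^ 2 / INR (fact (2 * n)).

Lemma fact_2S (n : nat) :
  INR (fact (2 * S n)) = (2 * INR n + 2) * (2 * INR n + 1) * INR (fact (2 * n)).
Proof.
  replace (2 * S n)%nat with (S (S (2 * n))) by lia.
  change (fact (S (S (2 * n)))) with (S (S (2 * n)) * (S (2 * n) * fact (2 * n)))%nat.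
  rewrite !mult_INR, !S_INR, mult_INR; change (INR 2) with 2; ring.
Qed.

Lemma Wallis_prod_pos (n : nat) : 0 < Wallis_prod n.
Proof.
  apply Rdiv_lt_0_compat; [|apply INR_fact_lt_0].
  apply Rmult_lt_0_compat; apply pow_lt; [lra | apply INR_fact_lt_0].
Qed.

Lemma Wallis_prod_S (n : nat) :
  Wallis_prod (S n) = Wallis_prod n * (2 * INR n + 2) / (2 * INR n + 1).
Proof.
  unfold Wallis_prod; rewrite fact_2S.
  change (fact (S n)) with (S n * fact n)%nat; rewrite mult_INR, S_INR.
  generalize (pos_INR n) (INR_fact_lt_0 (2 * n)); intros; simpl pow; field; split; lra.
Qed.

Lemma Wallis_int_even (n : nat) : Wallis_int (2 * n) * Wallis_prod n = PI / 2.
Proof.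
  induction n as [|n IH].
  - simpl (2 * 0)%nat; rewrite Wallis_int_0; unfold Wallis_prod; simpl; field.
  - rewrite Wallis_prod_S, <- IH; replace (2 * S n)%nat with (S (S (2 * n))) by lia.
    assert (H := Wallis_int_SS (2 * n)); rewrite !S_INR, mult_INR in H; change (INR 2) with 2 in H.
    generalize (pos_INR n); intros.
    replace (Wallis_int (S (S (2 * n)))) with ((2 * INR n + 1) * Wallis_int (2 * n) / (2 * INR n + 2)).
    + field; split; lra.
    + rewrite <- H; field; lra.
Qed.

Lemma Wallis_int_odd (n : nat) : Wallis_int (S (2 * n)) * (2 * INR n + 1) = Wallis_prod n.
Proof.
  induction n as [|n IH].
  - simpl (S (2 * 0)); rewrite Wallis_int_1; unfold Wallis_prod; simpl; field.
  - rewrite Wallis_prod_S, <- IH; replace (S (2 * S n))%nat with (S (S (S (2 * n)))) by lia.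
    assert (H := Wallis_int_SS (S (2 * n))); rewrite !S_INR, mult_INR in H; change (INR 2) with 2 in H.
    generalize (pos_INR n); intros; rewrite S_INR.
    replace (2 * (INR n + 1) + 1) with (2 * INR n + 1 + 1 + 1) by ring.
    rewrite Rmult_comm, H; field; lra.
Qed.

(** Let [p] be the product at [m = n + 1]. The sine integrals of exponents [2m], [2m+1], [2m+2]
    decrease; multiplied by [p] they become [PI / 2], [p^2 / (2m+1)] and
    [(2m+1) / (2m+2) * PI / 2]. *)
Lemma Wallis_prod_bounds (n : nat) :
  PI * INR (S n) <= Wallis_prod (S n) ^ 2 <= PI * (INR (S n) + / 2).
Proof.
  assert (P := Wallis_prod_pos (S n)); set (p := Wallis_prod (S n)) in *.
  assert (X : 0 < INR (S n)) by (apply lt_0_INR; lia); set (x := INR (S n)) in *.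
  assert (E := Wallis_int_even (S n)); fold p in E.
  assert (O := Wallis_int_odd (S n)); fold p x in O.
  assert (Rc := Wallis_int_SS (2 * S n)).
  rewrite (S_INR (S (2 * S n))), (S_INR (2 * S n)), mult_INR in Rc.
  change (INR 2) with 2 in Rc; fold x in Rc.
  assert (D1 := Wallis_int_decr (2 * S n)).
  assert (D2 := Wallis_int_decr (S (2 * S n))).
  set (a := Wallis_int (2 * S n)) in *.
  set (b := Wallis_int (S (2 * S n))) in *.
  set (c := Wallis_int (S (S (2 * S n)))) in *.
  split.
  - assert (K : c * p <= b * p) by nra.
    assert (K1 : (2 * x + 2) * (c * p) = (2 * x + 1) * (PI / 2)) by (rewrite <- E; nra).
    assert (K2 : (2 * x + 1) * (b * p) = p ^ 2) by (rewrite <- O at 2; simpl; ring_simplify; rewrite <- O; ring).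
    assert (K3 : (2 * x + 1) * ((2 * x + 1) * (PI / 2)) <= (2 * x + 2) * p ^ 2).
    { rewrite <- K1, <- K2.
      replace ((2 * x + 2) * ((2 * x + 1) * (b * p))) with ((2 * x + 1) * (2 * x + 2) * (b * p)) by ring.
      replace ((2 * x + 1) * ((2 * x + 2) * (c * p))) with ((2 * x + 1) * (2 * x + 2) * (c * p)) by ring.
      apply Rmult_le_compat_l; nra. }
    generalize PI_RGT_0; intros.
    (* What is left is [4 x (x + 1) <= (2 x + 1)^2]. *)
    apply Rmult_le_reg_l with (2 * x + 2); [lra|].
    apply Rle_trans with (2 := K3); nra.
  - assert (K : b * p <= a * p) by nra.
    assert (K2 : (2 * x + 1) * (b * p) = p ^ 2) by (rewrite <- O at 2; simpl; ring_simplify; rewrite <- O; ring).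
    rewrite E in K; nra.
Qed.

Lemma Wallis_lim : is_lim_seq (fun n => Wallis_prod (S n) / sqrt (INR (S n))) (sqrt PI).
Proof.
  apply is_lim_seq_ext with (fun n => sqrt (Wallis_prod (S n) ^ 2 / INR (S n))).
  { intros n; assert (0 < INR (S n)) by (apply lt_0_INR; lia).
    rewrite sqrt_div by (auto; apply pow2_ge_0).
    rewrite sqrt_pow2; [reflexivity | left; apply Wallis_prod_pos]. }
  apply (is_lim_seq_continuous sqrt); [apply continuity_pt_sqrt; left; exact PI_RGT_0|].
  apply is_lim_seq_le_le with (fun _ => PI) (fun n => PI + PI / 2 * / INR (S n)).
  - intros n; assert (X : 0 < INR (S n)) by (apply lt_0_INR; lia).
    destruct (Wallis_prod_bounds n) as [B1 B2]; split.
    + exact (proj1 (Rle_div_r _ _ _ X) B1).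
    + apply (Rle_div_l _ _ _ X).
      replace ((PI + PI / 2 * / INR (S n)) * INR (S n)) with (PI * (INR (S n) + / 2)) by (field; lra).
      exact B2.
  - apply is_lim_seq_const.
  - replace (Finite PI) with (Finite (PI + PI / 2 * 0)) by (f_equal; ring).
    apply is_lim_seq_plus'; [apply is_lim_seq_const|].
    apply is_lim_seq_mult'; [apply is_lim_seq_const | apply is_lim_seq_inv_INR_S].
Qed.

(** Each step uses [(2w + 2n) (2w + 2n + 1) = 4 (w + n) (w + n + 1/2)]. The invariance of the
    quotient is stated in cross-multiplied form, so nothing has to be divided by. *)
Lemma Euler_Gamma_duplication_shift (w : C) (n : nat) : 0 < Re w ->
  (Euler_Gamma (2 * w + RtoC (INR (2 * n))) * (Euler_Gamma w * Euler_Gamma (w + RtoC (/ 2))))%C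
  = (RtoC (4 ^ n) * Euler_Gamma (2 * w)
      * (Euler_Gamma (w + RtoC (INR n)) * Euler_Gamma (w + RtoC (/ 2) + RtoC (INR n))))%C.
Proof.
  intros Hw; induction n as [|n IH]; [simpl; rewrite !Cplus_0_r; ring|].
  assert (Hn := pos_INR n).
  assert (R2 : Re (2 * w)%C = 2 * Re w) by (rewrite re_scal_l; reflexivity).
  replace (2 * w + RtoC (INR (2 * S n)))%C with (2 * w + RtoC (INR (2 * n)) + 1 + 1)%C.
  2: { replace (2 * S n)%nat with (2 * n + 2)%nat by lia.
       rewrite plus_INR, RtoC_plus; change (INR 2) with 2.
       apply injective_projections; simpl; ring. }
  rewrite S_INR, !RtoC_plus, !Cplus_assoc.
  assert (M : 0 <= INR (2 * n)) by apply pos_INR.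
  rewrite !Euler_Gamma_succ by (rewrite !re_plus, ?R2, !re_RtoC; lra).
  transitivity ((2 * w + RtoC (INR (2 * n)) + 1) * (2 * w + RtoC (INR (2 * n)))
    * (Euler_Gamma (2 * w + RtoC (INR (2 * n))) * (Euler_Gamma w * Euler_Gamma (w + RtoC (/ 2)))))%C;
    [ring|].
  rewrite IH; simpl pow; rewrite mult_INR, !RtoC_mult; change (INR 2) with 2.
  replace (w + RtoC (/ 2) + RtoC (INR n))%C with (w + RtoC (INR n) + / 2)%C
    by (rewrite RtoC_inv by lra; ring).
  replace (RtoC 4) with (2 * 2)%C by (apply injective_projections; simpl; ring).
  field.
Qed.

Lemma Euler_Gamma_Gamma_ratio (z : C) (n : nat) :
  Euler_Gamma (z + RtoC (INR (S n)))
  = (Gamma_ratio z n * RtoC (INR (fact n)) * Cexp (z * RtoC (ln (INR (S n)))))%C.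
Proof.
  unfold Gamma_ratio; set (c := (z * RtoC (ln (INR (S n))))%C).
  transitivity (Euler_Gamma (z + RtoC (INR (S n))) * (Cexp c * Cexp (- c)))%C.
  - rewrite Cexp_neg; ring.
  - field; apply RtoC_fact_neq_0.
Qed.

Lemma Cmult_reg_r (c a b : C) : c <> 0 -> (a * c)%C = (b * c)%C -> a = b.
Proof.
  intros Hc H; transitivity (a * c / c)%C; [field; exact Hc|].
  rewrite H; field; exact Hc.
Qed.

(** One sequence is given two limits: the left side times a ratio tending to 1, and, rewritten by
    the shift identity, a form in which the factorials collect into Wallis' product and produce
    [sqrt PI]. *)
Lemma Euler_Gamma_duplication (w : C) : 0 < Re w ->
  (Euler_Gamma w * Euler_Gamma (w + RtoC (/ 2)) * Cexp (2 * w * RtoC (ln 2)))%C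
  = (2 * RtoC (sqrt PI) * Euler_Gamma (2 * w))%C.
Proof.
  intros Hw.
  assert (R2 : 0 < Re (2 * w)%C) by (rewrite re_scal_l; simpl; lra).
  assert (Rh : 0 < Re (w + RtoC (/ 2))%C) by (rewrite re_plus, re_RtoC; lra).
  apply (is_Clim_seq_unique (fun n => Euler_Gamma w * Euler_Gamma (w + RtoC (/ 2))
    * Cexp (2 * w * RtoC (ln 2)) * Gamma_ratio (2 * w) (S (2 * n)))%C).
  - assert (M := is_Clim_seq_mult _ _ _ _
      (is_Clim_seq_const (Euler_Gamma w * Euler_Gamma (w + RtoC (/ 2)) * Cexp (2 * w * RtoC (ln 2)))%C)
      (Gamma_ratio_lim _ R2)).
    rewrite Cmult_1_r in M.
    (* Index [n] of [Gamma_ratio] means a shift by [n + 1]. Doubling that shift gives [2 n + 2],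
       which is index [2 n + 1]. *)
    apply (is_lim_seq_subseq _ _ (fun n => S (2 * n))) in M; [exact M|].
    apply eventually_subseq; intros n; lia.
  - apply is_Clim_seq_ext with (fun n => 2 * RtoC (Wallis_prod (S n) / sqrt (INR (S n)))
      * Euler_Gamma (2 * w) * (Gamma_ratio w n * Gamma_ratio (w + RtoC (/ 2)) n))%C.
    + intros n; assert (H := Euler_Gamma_duplication_shift w (S n) Hw).
      replace (2 * S n)%nat with (S (S (2 * n))) in H by lia.
      rewrite !Euler_Gamma_Gamma_ratio in H.
      assert (X : 0 < INR (S n)) by (apply lt_0_INR; lia).
      replace (INR (S (S (2 * n)))) with (2 * INR (S n)) in H
        by (rewrite !S_INR, mult_INR; change (INR 2) with 2; ring).
      rewrite ln_mult in H by lra.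
      set (L := RtoC (ln (INR (S n)))) in *.
      replace (2 * w * RtoC (ln 2 + ln (INR (S n))))%C with (2 * w * RtoC (ln 2) + 2 * w * L)%C in H
        by (rewrite RtoC_plus; unfold L; ring).
      replace ((w + RtoC (/ 2)) * L)%C with (w * L + RtoC (/ 2 * ln (INR (S n))))%C in H
        by (rewrite RtoC_mult; unfold L; ring).
      rewrite !Cexp_plus, Cexp_RtoC in H.
      replace (Cexp (2 * w * L)) with (Cexp (w * L) * Cexp (w * L))%C in H
        by (rewrite <- Cexp_plus; f_equal; ring).
      (* With [N = n + 1], the powers are [(2N)^(2w)] on one side and [N^w N^(w + 1/2)] on the
         other: [N^(2w)] cancels, leaving [2^(2w)] and this [sqrt N]. *)
      replace (exp (/ 2 * ln (INR (S n)))) with (sqrt (INR (S n))) in H.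
      2: { rewrite <- Rpower_sqrt by auto; reflexivity. }
      assert (N0 := Cexp_neq_0 (w * L)).
      assert (F0 : RtoC (INR (fact (S (2 * n)))) <> 0) by apply RtoC_fact_neq_0.
      assert (Sq : 0 < sqrt (INR (S n))) by (apply sqrt_lt_R0, X).
      assert (Wp : 2 * (Wallis_prod (S n) / sqrt (INR (S n))) * INR (fact (S (2 * n)))
        = 4 ^ S n * INR (fact n) * INR (fact n) * sqrt (INR (S n))).
      { unfold Wallis_prod; rewrite fact_2S.
        change (fact (S n)) with (S n * fact n)%nat.
        change (fact (S (2 * n))) with (S (2 * n) * fact (2 * n))%nat.
        assert (F2 := INR_fact_lt_0 (2 * n)); assert (Hn := pos_INR n).
        rewrite !mult_INR, (S_INR (2 * n)), mult_INR; change (INR 2) with 2.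
        replace (2 * INR n + 2) with (2 * INR (S n)) by (rewrite S_INR; ring).
        assert (Q : INR (S n) = sqrt (INR (S n)) * sqrt (INR (S n))) by (rewrite sqrt_sqrt; lra).
        set (q := sqrt (INR (S n))) in *; clearbody q; rewrite Q; field; repeat split; lra. }
      apply (f_equal RtoC) in Wp; rewrite !RtoC_mult in Wp.
      apply (Cmult_reg_r _ _ _ F0).
      apply (Cmult_reg_r _ _ _ N0), (Cmult_reg_r _ _ _ N0).
      transitivity (2 * RtoC (Wallis_prod (S n) / sqrt (INR (S n))) * RtoC (INR (fact (S (2 * n))))
        * (Euler_Gamma (2 * w) * (Gamma_ratio w n * Gamma_ratio (w + RtoC (/ 2)) n)
           * Cexp (w * L) * Cexp (w * L)))%C; [ring|].
      rewrite Wp.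
      transitivity (Gamma_ratio (2 * w) (S (2 * n)) * INR (fact (S (2 * n))) *
        (Cexp (2 * w * ln 2) * (Cexp (w * L) * Cexp (w * L))) *
        (Euler_Gamma w * Euler_Gamma (w + (/ 2)%R)))%C; [rewrite H|]; ring.
    + assert (M := is_Clim_seq_mult _ _ _ _
        (is_Clim_seq_mult _ _ _ _ (is_Clim_seq_mult _ _ _ _ (is_Clim_seq_const 2)
           (is_Clim_seq_RtoC _ _ Wallis_lim)) (is_Clim_seq_const (Euler_Gamma (2 * w))))
        (is_Clim_seq_mult _ _ _ _ (Gamma_ratio_lim _ Hw) (Gamma_ratio_lim _ Rh))).
      rewrite !Cmult_1_r in M; exact M.
Qed.

(** * The Bessel series *)

Lemma Cexp_Clog (arg : C -> R) (z : C) : arg_branch arg -> z <> 0 -> Cexp (Clog arg z) = z.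
Proof.
  intros Ha Hz; rewrite (arg_polar arg Ha z Hz) at 2.
  unfold Cexp, Clog; simpl; rewrite exp_ln by (apply Cmod_gt_0, Hz); reflexivity.
Qed.

Lemma Cpower_pos (arg : C -> R) (x : R) (nu : C) : arg_branch arg -> 0 < x ->
  Cpower arg (RtoC x) nu = Cexp (nu * RtoC (ln x)).
Proof.
  intros Ha Hx; unfold Cpower, Clog.
  destruct (Ceq_dec (RtoC x) 0) as [E|_]; [apply RtoC_inj in E; lra|].
  rewrite (arg_pos arg Ha x Hx), Cmod_R, Rabs_pos_eq by lra; reflexivity.
Qed.

(** Constancy of the argument on rays makes the power multiplicative for a positive factor. At
    [z = 0] both sides are 0, or both are 1 when [nu = 0]. *)
Lemma Cpower_scale (arg : C -> R) (r : R) (z nu : C) : arg_branch arg -> 0 < r ->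
  Cpower arg (RtoC r * z) nu = (Cexp (nu * RtoC (ln r)) * Cpower arg z nu)%C.
Proof.
  intros Ha Hr; assert (Hr' : RtoC r <> 0) by (intros H; apply RtoC_inj in H; lra).
  unfold Cpower; destruct (Ceq_dec z 0) as [Hz|Hz].
  - subst z; destruct (Ceq_dec (RtoC r * 0) 0) as [_|N]; [|contradiction N; ring].
    destruct (Ceq_dec nu 0) as [->|_]; [|ring].
    rewrite Cmult_0_l, Cexp_0; ring.
  - destruct (Ceq_dec (RtoC r * z) 0) as [N|_]; [exfalso; revert N; apply Cmult_neq_0; auto|].
    rewrite <- Cexp_plus; f_equal; unfold Clog.
    assert (Hm : 0 < Cmod z) by (apply Cmod_gt_0, Hz).
    rewrite (arg_ray arg Ha r z Hr Hz), Cmod_mult, Cmod_R, Rabs_pos_eq, ln_mult by lra.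
    apply injective_projections; simpl; ring.
Qed.

(** At [z = 0] the right side is 0, so the exponent [nu + 2] must not be 0, where the power would be
    1; the hypothesis excludes this. *)
Lemma Cpower_plus_2 (arg : C -> R) (z nu : C) : arg_branch arg -> 0 < Re (nu + 2)%C ->
  Cpower arg z (nu + 2) = (z * z * Cpower arg z nu)%C.
Proof.
  intros Ha Hn; unfold Cpower; destruct (Ceq_dec z 0) as [Hz|Hz].
  - destruct (Ceq_dec (nu + 2) 0) as [E|_]; [rewrite E in Hn; simpl in Hn; lra|].
    subst z; ring.
  - replace ((nu + 2) * Clog arg z)%C with (Clog arg z + (Clog arg z + nu * Clog arg z))%C by ring.
    rewrite !Cexp_plus, Cexp_Clog by auto; ring.
Qed.

(** Here [up (- Re z) <= 0], so [Z.to_nat] returns 0 and the rising product is empty. *)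
Lemma rGamma_pos (z : C) : 0 < Re z -> rGamma z = (/ Euler_Gamma z)%C.
Proof.
  intros Hz; unfold rGamma.
  assert (S : Gamma_shift z = 0%nat).
  { unfold Gamma_shift; destruct (archimed (- Re z)) as [_ H].
    assert (L : IZR (up (- Re z)) < 1) by lra; apply lt_IZR in L.
    destruct (up (- Re z)); simpl; auto; lia. }
  rewrite S; simpl; rewrite Cplus_0_r; unfold Cdiv; ring.
Qed.

Definition Cbessel_term (arg : C -> R) (nu z : C) (s : nat) : C :=
  (RtoC ((-1) ^ s / INR (fact s)) * rGamma (nu + RtoC (INR s + 1))
     * Cpower arg (RtoC (/ 2) * z) (nu + RtoC (2 * INR s)))%C.

(** The half-line integral enters in evaluated form: the exponent [nu + s - 1/2] of [t] makes it
    Gamma at [nu + s + 1/2]. *)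
Definition Cbessel_int_term (arg : C -> R) (nu z : C) (s : nat) : C :=
  (RtoC ((-1) ^ s / INR (fact s)) * Cpower arg z (nu + RtoC (2 * INR s))
     * rGamma (2 * nu + RtoC (2 * INR s + 1))
     * Euler_Gamma (nu + RtoC (INR s + / 2)))%C.

(** For this [w], [w + 1/2] is the Gamma argument [nu + s + 1] of the Bessel term and [2 w] the
    argument [2 nu + 2 s + 1] of the other one. *)
Lemma Cbessel_term_eq (arg : C -> R) (nu z : C) (s : nat) :
  arg_branch arg -> - / 2 < Re nu ->
  Cbessel_term arg nu z s
  = (Cpower arg 2 nu * RtoC (/ sqrt PI) * Cbessel_int_term arg nu z s)%C.
Proof.
  intros Ha Hn; assert (Hs := pos_INR s); unfold Cbessel_term, Cbessel_int_term.
  set (mu := (nu + RtoC (2 * INR s))%C); set (w := (nu + RtoC (INR s + / 2))%C).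
  assert (R1 : 0 < Re w) by (unfold w; rewrite re_plus, re_RtoC; lra).
  assert (R2 : 0 < Re (2 * w)%C) by (rewrite re_scal_l; lra).
  assert (R3 : 0 < Re (w + RtoC (/ 2))%C) by (rewrite re_plus, re_RtoC; lra).
  replace (nu + RtoC (INR s + 1))%C with (w + RtoC (/ 2))%C
    by (apply injective_projections; unfold w; simpl; field).
  replace (2 * nu + RtoC (2 * INR s + 1))%C with (2 * w)%C
    by (apply injective_projections; unfold w; simpl; field).
  rewrite !rGamma_pos by assumption.
  rewrite Cpower_scale, (Cpower_pos arg 2) by (auto; lra).
  assert (D := Euler_Gamma_duplication w R1).
  (* Since [2 w = nu + mu + 1], the factor [2^mu] undoes the scaling of [z] by one half, [2^nu] is
     the announced prefactor, and the last 2 cancels the 2 of the duplication formula. *)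
  assert (E : Cexp (2 * w * RtoC (ln 2)) = (Cexp (nu * RtoC (ln 2)) * Cexp (mu * RtoC (ln 2)) * 2)%C).
  { replace (RtoC 2) with (Cexp (RtoC (ln 2))) at 2 by (rewrite Cexp_RtoC, exp_ln by lra; reflexivity).
    rewrite <- !Cexp_plus; f_equal; apply injective_projections; unfold w, mu; simpl; field. }
  rewrite E in D; clear E.
  assert (I : Cexp (mu * RtoC (ln (/ 2))) = (/ Cexp (mu * RtoC (ln 2)))%C).
  { rewrite ln_Rinv by lra.
    replace (mu * RtoC (- ln 2))%C with (- (mu * RtoC (ln 2)))%C by (rewrite RtoC_opp; ring).
    apply (Cmult_reg_r (Cexp (mu * RtoC (ln 2)))); [apply Cexp_neq_0|].
    rewrite Cmult_comm, Cexp_neg; field; apply Cexp_neq_0. }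
  rewrite I; clear I.
  assert (G1 := Euler_Gamma_neq_0 _ R1); assert (G2 := Euler_Gamma_neq_0 _ R2).
  assert (G3 := Euler_Gamma_neq_0 _ R3).
  assert (X1 := Cexp_neq_0 (nu * RtoC (ln 2))); assert (X2 := Cexp_neq_0 (mu * RtoC (ln 2))).
  assert (Sp : 0 < sqrt PI) by apply sqrt_lt_R0, PI_RGT_0.
  assert (Sp' : RtoC (sqrt PI) <> 0) by (intros H; apply RtoC_inj in H; lra).
  assert (T : RtoC 2 <> 0) by (intros H; apply RtoC_inj in H; lra).
  rewrite (RtoC_inv (sqrt PI)) by lra.
  set (a := Cexp (nu * RtoC (ln 2))) in *; set (b := Cexp (mu * RtoC (ln 2))) in *.
  set (g := Euler_Gamma w) in *; set (g' := Euler_Gamma (w + RtoC (/ 2))) in *.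
  assert (K : Euler_Gamma (2 * w) = (g * g' * a * b / RtoC (sqrt PI))%C).
  { apply (Cmult_reg_r (2 * RtoC (sqrt PI))%C).
    - apply Cmult_neq_0; auto.
    - rewrite Cmult_comm, <- D; field; exact Sp'. }
  rewrite K; field; repeat split; assumption.
Qed.

(** Written as a product rather than a quotient of terms, so that [z = 0] is included. *)
Lemma Cbessel_term_succ (arg : C -> R) (nu z : C) (s : nat) :
  arg_branch arg -> - / 2 < Re nu ->
  Cbessel_term arg nu z (S s)
  = (- (RtoC (/ 2) * z * (RtoC (/ 2) * z)) / (RtoC (INR s + 1) * (nu + RtoC (INR s + 1)))
      * Cbessel_term arg nu z s)%C.
Proof.
  intros Ha Hn; assert (Hs := pos_INR s); unfold Cbessel_term.
  set (v := (nu + RtoC (INR s + 1))%C).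
  assert (R1 : 0 < Re v) by (unfold v; rewrite re_plus, re_RtoC; lra).
  assert (V0 : v <> 0) by (intros H; rewrite H in R1; simpl in R1; lra).
  assert (S0 : RtoC (INR s + 1) <> 0) by (intros H; apply RtoC_inj in H; lra).
  rewrite S_INR.
  replace (nu + RtoC (INR s + 1 + 1))%C with (v + 1)%C
    by (apply injective_projections; unfold v; simpl; ring).
  replace (nu + RtoC (2 * (INR s + 1)))%C with (nu + RtoC (2 * INR s) + 2)%C
    by (apply injective_projections; simpl; ring).
  rewrite Cpower_plus_2 by (auto; rewrite !re_plus, !re_RtoC; lra).
  rewrite !rGamma_pos by (auto; rewrite re_plus, re_RtoC; lra).
  rewrite Euler_Gamma_succ by auto.
  replace (RtoC ((-1) ^ S s / INR (fact (S s))))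
    with (- (1) / RtoC (INR s + 1) * RtoC ((-1) ^ s / INR (fact s)))%C.
  - field; repeat split; auto; apply Euler_Gamma_neq_0, R1.
  - change (fact (S s)) with (S s * fact s)%nat; rewrite mult_INR, S_INR.
    rewrite <- RtoC_m1, <- RtoC_div, <- RtoC_mult by lra; f_equal.
    simpl pow; field; split; [apply INR_fact_neq_0 | lra].
Qed.

(** Comparison with an exponential series: the denominator [nu + s + 1] has modulus at least [1/2],
    so each term is at most [M / (s + 1)] times the previous one, where the 2 in [M] is the inverse
    of that [1/2]. *)
Lemma ex_series_Cbessel_term (arg : C -> R) (nu z : C) :
  arg_branch arg -> - / 2 < Re nu ->
  ex_series (V := C_CompleteNormedModule) (Cbessel_term arg nu z).
Proof.
  intros Ha Hn; set (q := (RtoC (/ 2) * z * (RtoC (/ 2) * z))%C); set (M := 2 * Cmod q).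
  assert (HM : 0 <= M) by (unfold M; generalize (Cmod_ge_0 q); lra).
  set (c := Cmod (Cbessel_term arg nu z 0)).
  assert (Hc : 0 <= c) by apply Cmod_ge_0.
  assert (B : forall s, Cmod (Cbessel_term arg nu z s) <= c * (M ^ s / INR (fact s))).
  { induction s as [|s IH]; [simpl; fold c; lra|].
    rewrite Cbessel_term_succ by auto; fold q.
    assert (Hs := pos_INR s).
    set (v := (nu + RtoC (INR s + 1))%C).
    assert (R1 : / 2 < Re v) by (unfold v; rewrite re_plus, re_RtoC; lra).
    assert (V1 : / 2 <= Cmod v).
    { apply Rle_trans with (Rabs (Re v)); [rewrite Rabs_pos_eq; lra|].
      eapply Rle_trans; [apply Rmax_l | apply Rmax_Cmod]. }
    assert (S0 : RtoC (INR s + 1) <> 0) by (intros H; apply RtoC_inj in H; lra).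
    assert (V0 : v <> 0) by (intros H; rewrite H in R1; simpl in R1; lra).
    rewrite Cmod_mult, Cmod_div by (apply Cmult_neq_0; auto).
    rewrite Cmod_opp, Cmod_mult, Cmod_R, (Rabs_pos_eq (INR s + 1)) by lra.
    change (fact (S s)) with (S s * fact s)%nat; rewrite mult_INR, S_INR; simpl pow.
    assert (F := INR_fact_lt_0 s).
    replace (c * (M * M ^ s / ((INR s + 1) * INR (fact s))))
      with (M / (INR s + 1) * (c * (M ^ s / INR (fact s)))) by (field; split; lra).
    apply Rmult_le_compat; [|apply Cmod_ge_0| |exact IH].
    - apply Rdiv_le_0_compat; [apply Cmod_ge_0 | apply Rmult_lt_0_compat; lra].
    - apply (Rle_div_l _ _ _ (Rmult_lt_0_compat (INR s + 1) (Cmod v) ltac:(lra) ltac:(lra))).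
      replace (M / (INR s + 1) * ((INR s + 1) * Cmod v)) with (M * Cmod v) by (field; lra).
      unfold M; generalize (Cmod_ge_0 q); nra. }
  apply (ex_series_le (V := C_CompleteNormedModule) _ _ B).
  apply (ex_series_scal (K := R_AbsRing) (V := R_NormedModule) c).
  exists (exp M); generalize (is_exp_Reals M); apply is_series_ext; intros n.
  rewrite pow_n_pow; reflexivity.
Qed.

Lemma Cseries_unique (a : nat -> C) (l : C) :
  is_series (V := C_CompleteNormedModule) a l -> Cseries a = l.
Proof.
  intros H; apply (iota_unique (V := C_CompleteNormedModule)); [|exact H].
  intros y Hy; exact (filterlim_locally_unique (V := C_CompleteNormedModule) _ _ _ Hy H).
Qed.

(** * Transfer between coordinates and idempotent components *)

Lemma sum_n_pair (a : nat -> BC) (n : nat) :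
  sum_n (G := BC_NormedModule) a n
  = (sum_n (G := C_NormedModule) (fun k => fst (a k)) n,
     sum_n (G := C_NormedModule) (fun k => snd (a k)) n).
Proof.
  induction n as [|n IH].
  - rewrite !sum_O; apply surjective_pairing.
  - rewrite !sum_Sn, IH; reflexivity.
Qed.

Lemma is_series_pair (a : nat -> BC) (x y : C) :
  is_series (V := C_NormedModule) (fun n => fst (a n)) x ->
  is_series (V := C_NormedModule) (fun n => snd (a n)) y ->
  is_series (V := BC_NormedModule) a (x, y).
Proof.
  intros Hx Hy P [e He].
  assert (Hx' := Hx _ (locally_ball x e)); assert (Hy' := Hy _ (locally_ball y e)).
  unfold filtermap in *; generalize (filter_and _ _ Hx' Hy'); apply filter_imp.
  intros n [H1 H2]; rewrite sum_n_pair; apply He; split; assumption.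
Qed.

Lemma BC_fst_idem (Z : BC) : fst Z = (/ 2 * (idem1 Z + idem2 Z))%C.
Proof. rewrite <- (idem_repr Z) at 1; rewrite idemE; simpl; unfold Cdiv; ring. Qed.

Lemma BC_snd_idem (Z : BC) : snd Z = (Ci / 2 * (idem1 Z - idem2 Z))%C.
Proof. rewrite <- (idem_repr Z) at 1; rewrite idemE; simpl; unfold Cdiv; ring. Qed.

(** [BCseries] sums the coordinates over 1 and [j], whereas the analysis is done on idempotent
    components. The two pairs differ by a fixed [C]-linear map, which commutes with sums of
    series. *)
Lemma BCseries_idem (a : nat -> BC) (l1 l2 : C) :
  is_series (V := C_CompleteNormedModule) (fun n => idem1 (a n)) l1 ->
  is_series (V := C_CompleteNormedModule) (fun n => idem2 (a n)) l2 ->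
  ex_series (V := BC_NormedModule) a /\ BCseries a = idem l1 l2.
Proof.
  intros H1 H2.
  assert (F : is_series (V := C_CompleteNormedModule) (fun n => fst (a n)) (/ 2 * (l1 + l2))%C).
  { apply is_series_ext with (fun n => (/ 2 * (idem1 (a n) + idem2 (a n)))%C);
      [intros; symmetry; apply BC_fst_idem|].
    exact (is_series_scal_l (V := C_NormedModule) (/ 2)%C _ _
      (is_series_plus (V := C_NormedModule) _ _ _ _ H1 H2)). }
  assert (S : is_series (V := C_CompleteNormedModule) (fun n => snd (a n)) (Ci / 2 * (l1 - l2))%C).
  { apply is_series_ext with (fun n => (Ci / 2 * (idem1 (a n) - idem2 (a n)))%C);
      [intros; symmetry; apply BC_snd_idem|].
    exact (is_series_scal_l (V := C_NormedModule) (Ci / 2)%C _ _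
      (is_series_minus (V := C_NormedModule) _ _ _ _ H1 H2)). }
  split; [eexists; apply is_series_pair; [exact F | exact S]|].
  unfold BCseries; rewrite (Cseries_unique _ _ F), (Cseries_unique _ _ S), idemE.
  unfold Cdiv; f_equal; ring.
Qed.

Lemma idem1_plus (Z W : BC) : idem1 (Z + W)%BC = (idem1 Z + idem1 W)%C.
Proof. unfold idem1, BCplus; simpl; ring. Qed.

Lemma idem2_plus (Z W : BC) : idem2 (Z + W)%BC = (idem2 Z + idem2 W)%C.
Proof. unfold idem2, BCplus; simpl; ring. Qed.

Lemma idem1_opp (Z : BC) : idem1 (- Z)%BC = (- idem1 Z)%C.
Proof. unfold idem1, BCopp; simpl; ring. Qed.

Lemma idem2_opp (Z : BC) : idem2 (- Z)%BC = (- idem2 Z)%C.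
Proof. unfold idem2, BCopp; simpl; ring. Qed.

Lemma idem1_RtoBC (x : R) : idem1 (RtoBC x) = RtoC x.
Proof. unfold idem1, RtoBC, CtoBC; simpl; ring. Qed.

Lemma idem2_RtoBC (x : R) : idem2 (RtoBC x) = RtoC x.
Proof. unfold idem2, RtoBC, CtoBC; simpl; ring. Qed.

Lemma BC_eq_idem (Z W : BC) : idem1 Z = idem1 W -> idem2 Z = idem2 W -> Z = W.
Proof. intros H1 H2; rewrite <- (idem_repr Z), <- (idem_repr W), H1, H2; reflexivity. Qed.

(** * Evaluation of the integrals and reduction of both series to components *)

Definition Cbessel_integrand (arg : C -> R) (nu : C) (s : nat) (t : C) : C :=
  (Cexp (- t) * Cpower arg t (nu + RtoC (INR s - / 2)))%C.

Lemma idem1_Bessel_integrand (arg : C -> R) (V : BC) (s : nat) (t : BC) :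
  idem1 (Bessel_integrand arg V s t) = Cbessel_integrand arg (idem1 V) s (idem1 t).
Proof.
  unfold Bessel_integrand, BCexp, BCpower.
  rewrite idem1_mult, !idem1_idem, idem1_plus, idem1_opp, idem1_RtoBC; reflexivity.
Qed.

Lemma idem2_Bessel_integrand (arg : C -> R) (V : BC) (s : nat) (t : BC) :
  idem2 (Bessel_integrand arg V s t) = Cbessel_integrand arg (idem2 V) s (idem2 t).
Proof.
  unfold Bessel_integrand, BCexp, BCpower.
  rewrite idem2_mult, !idem2_idem, idem2_plus, idem2_opp, idem2_RtoBC; reflexivity.
Qed.

Lemma is_Cint_Cbessel_integrand (arg : C -> R) (nu : C) (s : nat) :
  arg_branch arg -> - / 2 < Re nu ->
  is_Cint (fun t => Cbessel_integrand arg nu s (RtoC t)) (Euler_Gamma (nu + RtoC (INR s + / 2))).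
Proof.
  intros Ha Hn; apply is_Cint_ext with (Euler_kernel (nu + RtoC (INR s + / 2))).
  - intros t Ht; unfold Cbessel_integrand, Euler_kernel.
    rewrite Cpower_pos, <- RtoC_opp, Cexp_RtoC by auto; do 3 f_equal.
    apply injective_projections; simpl; field.
  - apply Euler_Gamma_correct; rewrite re_plus, re_RtoC; generalize (pos_INR s); lra.
Qed.

Lemma BCint_Bessel_integrand (arg : C -> R) (V : BC) (s : nat) :
  arg_branch arg -> - / 2 < Re (idem1 V) -> - / 2 < Re (idem2 V) ->
  BCint (Bessel_integrand arg V s)
  = idem (Euler_Gamma (idem1 V + RtoC (INR s + / 2))) (Euler_Gamma (idem2 V + RtoC (INR s + / 2))).
Proof.
  intros Ha H1 H2; unfold BCint; f_equal.
  - eapply Cint_ext; [|apply (is_Cint_Cbessel_integrand arg); auto].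
    intros t _; cbv beta; rewrite idem1_Bessel_integrand, idem1_idem; reflexivity.
  - eapply Cint_ext; [|apply (is_Cint_Cbessel_integrand arg); auto].
    intros t _; cbv beta; rewrite idem2_Bessel_integrand, idem2_idem; reflexivity.
Qed.

Lemma is_BCint_Bessel_integrand (arg : C -> R) (V : BC) (s : nat) :
  arg_branch arg -> - / 2 < Re (idem1 V) -> - / 2 < Re (idem2 V) ->
  is_BCint (Bessel_integrand arg V s) (BCint (Bessel_integrand arg V s)).
Proof.
  intros Ha H1 H2.
  exists (fun t => Cbessel_integrand arg (idem1 V) s (RtoC t)),
         (fun t => Cbessel_integrand arg (idem2 V) s (RtoC t)).
  rewrite BCint_Bessel_integrand, idem1_idem, idem2_idem by auto; split; [|split].
  - intros t1 t2 _ _; apply BC_eq_idem.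
    + rewrite idem1_Bessel_integrand, !idem1_idem; reflexivity.
    + rewrite idem2_Bessel_integrand, !idem2_idem; reflexivity.
  - apply is_Cint_Cbessel_integrand; auto.
  - apply is_Cint_Cbessel_integrand; auto.
Qed.

Lemma idem_Bessel_term (arg : C -> R) (V Z : BC) (s : nat) :
  idem1 (Bessel_term arg V Z s) = Cbessel_term arg (idem1 V) (idem1 Z) s /\
  idem2 (Bessel_term arg V Z s) = Cbessel_term arg (idem2 V) (idem2 Z) s.
Proof.
  unfold Bessel_term, BCrGamma, BCpower; split.
  - rewrite !idem1_mult, !idem1_idem, !idem1_plus, !idem1_RtoBC; reflexivity.
  - rewrite !idem2_mult, !idem2_idem, !idem2_plus, !idem2_RtoBC; reflexivity.
Qed.

Lemma idem_Bessel_int_term (arg : C -> R) (V Z : BC) (s : nat) :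
  arg_branch arg -> - / 2 < Re (idem1 V) -> - / 2 < Re (idem2 V) ->
  idem1 (Bessel_int_term arg V Z s) = Cbessel_int_term arg (idem1 V) (idem1 Z) s /\
  idem2 (Bessel_int_term arg V Z s) = Cbessel_int_term arg (idem2 V) (idem2 Z) s.
Proof.
  intros Ha H1 H2.
  unfold Bessel_int_term, BCrGamma, BCpower; rewrite BCint_Bessel_integrand by auto; split.
  - rewrite !idem1_mult, !idem1_idem, !idem1_plus, idem1_mult, !idem1_RtoBC; reflexivity.
  - rewrite !idem2_mult, !idem2_idem, !idem2_plus, idem2_mult, !idem2_RtoBC; reflexivity.
Qed.

(** The series with integrals needs no estimate of its own: term by term it is the Bessel series
    divided by the nonzero constant [2^nu / sqrt PI]. *)
Lemma Cbessel_series (arg : C -> R) (nu z : C) :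
  arg_branch arg -> - / 2 < Re nu -> exists l,
  is_series (V := C_CompleteNormedModule) (Cbessel_int_term arg nu z) l /\
  is_series (V := C_CompleteNormedModule) (Cbessel_term arg nu z)
    (Cpower arg 2 nu * RtoC (/ sqrt PI) * l)%C.
Proof.
  intros Ha Hn; destruct (ex_series_Cbessel_term arg nu z Ha Hn) as [l Hl].
  set (k := (Cpower arg 2 nu * RtoC (/ sqrt PI))%C).
  assert (K : k <> 0).
  { apply Cmult_neq_0; [rewrite Cpower_pos by (auto; lra); apply Cexp_neq_0|].
    intros H; apply RtoC_inj in H; revert H; apply Rinv_neq_0_compat.
    apply Rgt_not_eq, sqrt_lt_R0, PI_RGT_0. }
  assert (L : (k * (/ k * l))%C = (l : C)) by (field; exact K).
  exists (/ k * l)%C; split.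
  - assert (E : forall s, (/ k * Cbessel_term arg nu z s)%C = Cbessel_int_term arg nu z s).
    { intros s; rewrite Cbessel_term_eq by auto; fold k; field; exact K. }
    apply is_series_ext with (1 := E).
    exact (is_series_scal_l (V := C_NormedModule) (/ k)%C _ _ Hl).
  - rewrite L; exact Hl.
Qed.

Theorem theorem3p4 :
  forall (arg : C -> R) (Z V : BC),
    arg_branch arg ->
    Rabs (Im (snd V)) < Re (fst V) + / 2 ->
    BCpower_defined Z V ->
    ex_series (V := BC_NormedModule) (Bessel_term arg V Z)
    /\ (forall s : nat,
          is_BCint (Bessel_integrand arg V s)
            (BCint (Bessel_integrand arg V s)))
    /\ ex_series (V := BC_NormedModule) (Bessel_int_term arg V Z)
    /\ BCBessel arg V Z
       = (BCpower arg (RtoBC 2) V * RtoBC (/ sqrt PI)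
            * BCseries (Bessel_int_term arg V Z))%BC.
Proof.
  intros arg Z V Ha HV _.
  apply Rabs_def2 in HV; destruct HV as [HV1 HV2].
  (* The components have real parts [Re (fst V) + Im (snd V)] and [Re (fst V) - Im (snd V)]; the
     bound on the absolute value puts both above [-1/2]. *)
  assert (H1 : - / 2 < Re (idem1 V)).
  { destruct V as [[? ?] [? ?]]; simpl in *; unfold Re, Im in *; simpl in *; lra. }
  assert (H2 : - / 2 < Re (idem2 V)).
  { destruct V as [[? ?] [? ?]]; simpl in *; unfold Re, Im in *; simpl in *; lra. }
  destruct (Cbessel_series arg (idem1 V) (idem1 Z) Ha H1) as [l1 [I1 J1]].
  destruct (Cbessel_series arg (idem2 V) (idem2 Z) Ha H2) as [l2 [I2 J2]].
  destruct (BCseries_idem (Bessel_term arg V Z) _ _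
    (is_series_ext _ _ _ (fun s => eq_sym (proj1 (idem_Bessel_term arg V Z s))) J1)
    (is_series_ext _ _ _ (fun s => eq_sym (proj2 (idem_Bessel_term arg V Z s))) J2)) as [A1 A2].
  destruct (BCseries_idem (Bessel_int_term arg V Z) _ _
    (is_series_ext _ _ _ (fun s => eq_sym (proj1 (idem_Bessel_int_term arg V Z s Ha H1 H2))) I1)
    (is_series_ext _ _ _ (fun s => eq_sym (proj2 (idem_Bessel_int_term arg V Z s Ha H1 H2))) I2))
    as [B1 B2].
  split; [exact A1 | split; [|split; [exact B1|]]].
  - intros s; apply is_BCint_Bessel_integrand; auto.
  - unfold BCBessel; rewrite A2, B2; unfold BCpower; apply BC_eq_idem.
    + rewrite !idem1_mult, !idem1_idem, !idem1_RtoBC; reflexivity.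
    + rewrite !idem2_mult, !idem2_idem, !idem2_RtoBC; reflexivity.
Qed.
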